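(* Let $0<s\le1$, let $\lambda$ be a real number, and let $h\in\mathcal{CV}_{hpl}(s)$ with $h(z)=z+d_2z^2+d_3z^3+\cdots$. Then $$|d_3-\lambda d_2^2|\le\begin{cases}-\dfrac{s^2}{4}\left(\lambda-\dfrac{3s+1}{3s}\right)&\text{for }\lambda\le\dfrac{3s-1}{3s},\\[1em]\dfrac{s}{6}&\text{for }\dfrac{3s-1}{3s}\le\lambda\le\dfrac{s+1}{s},\\[1em]\dfrac{s^2}{4}\left(\lambda-\dfrac{3s+1}{3s}\right)&\text{for }\lambda\ge\dfrac{s+1}{s}.\end{cases}$$ The inequalities are sharp: for every $0<s\le1$ and every real $\lambda$, equality is attained by some $h\in\mathcal{CV}_{hpl}(s)$.
   Context: Let $\mathbb{D}=\{z\in\mathbb{C}:|z|<1\}$, and let $\mathcal{S}$ be the class of functions $f(z)=z+\sum_{n\ge2}a_nz^n$ that are holomorphic and univalent in $\mathbb{D}$. For $0<s\le1$ put $\mathfrak{q}_s(z)=(1-z)^{-s}=e^{-s\ln(1-z)}$, $z\in\mathbb{D}$, with the branch of the logarithm such that $\mathfrak{q}_s(0)=1$. For holomorphic functions $p,F$ in $\mathbb{D}$, $p\prec F$ (subordination) means that there is a holomorphic $\omega:\mathbb{D}\to\mathbb{D}$ with $\omega(0)=0$ and $p(z)=F(\omega(z))$ for all $z\in\mathbb{D}$. The class $\mathcal{CV}_{hpl}(s)$ consists of all $f\in\mathcal{S}$ with $1+\frac{zf''(z)}{f'(z)}\prec\mathfrak{q}_s(z)$ in $\mathbb{D}$. 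*)

(* Defs.v *)
From Stdlib Require Import Reals Lra.
From Coquelicot Require Import Coquelicot.

Open Scope R_scope.

Definition in_disk (z : C) : Prop := Cmod z < 1.

(* The instances are fixed because Coquelicot has several normed-module
   structures on C; this one gives complex differentiability. *)
Definition holomorphic_on_disk (f : C -> C) : Prop :=
  forall z : C, in_disk z ->
    @ex_derive C_AbsRing C_NormedModule f z.

(* f(z) = z + a_2 z^2 + a_3 z^3 + ... on the unit disk. *)
Definition normalized_expansion (f : C -> C) (a : nat -> C) : Prop :=
  a 0%nat = RtoC 0 /\ a 1%nat = RtoC 1 /\
  forall z : C, in_disk z -> @is_pseries C_AbsRing C_NormedModule a z (f z).

Definition univalent_on_disk (f : C -> C) : Prop :=
  forall z w : C, in_disk z -> in_disk w -> f z = f w -> z = w.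

Definition class_S (f : C -> C) : Prop :=
  holomorphic_on_disk f /\ univalent_on_disk f /\
  exists a : nat -> C, normalized_expansion f a.

Definition subordinate (p F : C -> C) : Prop :=
  exists omega : C -> C,
    holomorphic_on_disk omega /\
    (forall z : C, in_disk z -> in_disk (omega z)) /\
    omega (RtoC 0) = RtoC 0 /\
    forall z : C, in_disk z -> p z = F (omega z).

Definition Cexp (z : C) : C :=
  (exp (Re z) * cos (Im z), exp (Re z) * sin (Im z)).

(* The principal logarithm on the half-plane Re w > 0 (a junk value outside).
   It is only applied to 1 - z with |z| < 1, which lies in this half-plane. *)
Definition Cln (w : C) : C := (ln (Cmod w), atan (Im w / Re w)).

Definition q (s : R) (z : C) : C := Cexp (- (RtoC s * Cln (RtoC 1 - z)))%C.

Definition class_CV_hpl (s : R) (f : C -> C) : Prop :=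
  class_S f /\
  subordinate
    (fun z : C => RtoC 1 + z * C_derive (C_derive f) z / C_derive f z)%C
    (q s).

Lemma Cexp_Cln (w : C) : 0 < Re w -> Cexp (Cln w) = w.
Proof.
destruct w as [x y]; unfold Cexp, Cln, Cmod; simpl; intros Hx.
assert (Hp : 0 < x * (x * 1) + y * (y * 1)) by nra.
assert (Hq : 0 < 1 + (y / x)²) by (generalize (Rle_0_sqr (y / x)); lra).
assert (E : sqrt (x * (x * 1) + y * (y * 1)) = x * sqrt (1 + (y / x)²)).
{ rewrite <- (sqrt_square x) at 3 by lra.
  rewrite <- sqrt_mult by nra.
  f_equal; unfold Rsqr; field; lra. }
rewrite exp_ln by (apply sqrt_lt_R0; assumption).
rewrite cos_atan, sin_atan, E.
assert (Hs := sqrt_lt_R0 _ Hq).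
f_equal; field; lra.
Qed.

Lemma q_0 (s : R) : q s (RtoC 0) = RtoC 1.
Proof.
unfold q, Cexp, Cln.
replace (RtoC 1 - RtoC 0)%C with (RtoC 1) by ring.
rewrite Cmod_1, ln_1; simpl.
replace (0 / 1) with 0 by field.
rewrite atan_0.
replace (- (s * 0 - 0 * 0)) with 0 by ring.
replace (- (s * 0 + 0 * 0)) with 0 by ring.
rewrite exp_0, cos_0, sin_0.
unfold RtoC; f_equal; ring.
Qed.

(* Main.v *)
Require Import Defs.
From Stdlib Require Import Reals Lra Lia.
From Coquelicot Require Import Coquelicot.

(** Write [q_s (w) = 1 + s w + s (s + 1) / 2 w^2 + ...] and let
    [1 + z h'' / h' = q_s (omega z)] with [omega z = c1 z + c2 z^2 + ...].
    Comparing coefficients gives [d2 = s c1 / 2] and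
    [d3 - lambda d2^2 = s / 6 * (c2 + mu c1^2)], where
    [mu = (3 s + 1 - 3 lambda s) / 2]. The Schwarz-Pick inequality
    [|c2| <= 1 - |c1|^2] bounds this by [s / 6 * max (1, |mu|)], and the three
    cases of the theorem are [mu >= 1], [|mu| <= 1] and [mu <= -1].

    The Schwarz-Pick inequality is obtained from circle means. Since
    [|omega| <= 1], the integral of [2 Re (omega u conj v)] over a circle is at
    most that of [|u|^2 + |v|^2]; with [u] and [v] polynomials with two terms
    this becomes the contraction property of a 2 by 2 triangular matrix in [c1]
    and [c2] ([schwarz_form]). Circle means of a function are computed by
    differentiating in the radius, which needs continuous derivatives. These
    are available because [omega] satisfies [omega' s p = p' (1 - omega)], where
    [p = 1 + z h'' / h'] is a quotient of power series; a Gronwall argument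
    ([singular_ode_no_zero]) shows that [h'] has no zero.

    For sharpness, [omega z = z] gives equality when [|mu| >= 1] and
    [omega z = z^2] when [|mu| <= 1]. For [omega z = z^m] the function is built
    from coefficients: [q_s (z^m)] has coefficients in [[0, 1]], hence so has the
    solution [h'] of [1 + z h'' / h' = q_s (z^m)], which therefore converges on the
    disk. Moreover [h' = Cexp L] with [z L' = q_s (z^m) - 1], and comparison with
    [s = 1] along rays gives [|Im L| < PI / 2] ([Im_log_series_bound]). Thus
    [Re h' > 0] and [h] is univalent. *)

Open Scope R_scope.

(** * Complex differentiability *)

(** Complex differentiability in epsilon-delta form. The predicate [is_derive]
    can be read in two normed-module structures on C; this form does not depend
    on that choice and suits estimates with [Cmod]. *)
Definition Cder (f : C -> C) (z l : C) : Prop :=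
  forall eps, 0 < eps -> exists del, 0 < del /\
    forall w, Cmod (w - z) < del ->
      Cmod (f w - f z - l * (w - z)) <= eps * Cmod (w - z).

Lemma Cder_is_derive (f : C -> C) (z l : C) :
  Cder f z l <-> @is_derive C_AbsRing C_NormedModule f z l.
Proof.
split.
- intros H; split; [apply is_linear_scal_l|].
  intros x Hx eps.
  apply (@is_filter_lim_locally_unique C_AbsRing (AbsRing_NormedModule C_AbsRing)) in Hx; rewrite <- Hx; clear x Hx.
  destruct (H eps (cond_pos eps)) as [d [Hd Hw]].
  exists (mkposreal d Hd); intros w Bw.
  specialize (Hw w Bw). rewrite Cmult_comm in Hw. exact Hw.
- intros [_ H] eps He.
  destruct (H z (fun P HP => HP) (mkposreal eps He)) as [d Hw].
  exists d; split; [apply cond_pos|]; intros w Bw.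
  specialize (Hw w Bw). rewrite Cmult_comm. exact Hw.
Qed.

(** The structure in which sums, products and compositions are differentiated. *)
Lemma Cder_is_derive_ring (f : C -> C) (z l : C) :
  Cder f z l <-> @is_derive C_AbsRing (AbsRing_NormedModule C_AbsRing) f z l.
Proof.
rewrite Cder_is_derive.
split; intros [_ H]; (split; [apply is_linear_scal_l|exact H]).
Qed.

Lemma Cder_ext_loc (f g : C -> C) (z l : C) (d : R) :
  0 < d -> (forall w, Cmod (w - z) < d -> f w = g w) -> Cder f z l -> Cder g z l.
Proof.
intros Hd E H eps He; destruct (H eps He) as [d' [Hd' H']].
exists (Rmin d d'); split; [apply Rmin_pos; lra|]; intros w Hw.
assert (Cmod (w - z) < d) by exact (Rlt_le_trans _ _ _ Hw (Rmin_l _ _)).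
assert (Ez : f z = g z).
{ apply E. replace (z - z)%C with (RtoC 0) by ring. rewrite Cmod_0; assumption. }
rewrite <- (E w H0), <- Ez.
apply H'. exact (Rlt_le_trans _ _ _ Hw (Rmin_r _ _)).
Qed.

Lemma RtoC_neq_0 (r : R) : r <> 0 -> RtoC r <> 0%C.
Proof. intros H E. apply H. exact (f_equal Re E). Qed.

Lemma Cder_const (c z : C) : Cder (fun _ => c) z 0.
Proof. apply Cder_is_derive_ring. apply @is_derive_const. Qed.

Lemma Cder_id (z : C) : Cder (fun w => w) z 1.
Proof. apply Cder_is_derive_ring. apply @is_derive_id. Qed.

Lemma Cder_plus (f g : C -> C) (z a b : C) :
  Cder f z a -> Cder g z b -> Cder (fun w => f w + g w)%C z (a + b)%C.
Proof. rewrite !Cder_is_derive_ring. intros. now apply @is_derive_plus. Qed.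

Lemma Cder_opp (f : C -> C) (z a : C) : Cder f z a -> Cder (fun w => - f w)%C z (- a)%C.
Proof. rewrite !Cder_is_derive_ring. intros. now apply @is_derive_opp. Qed.

Lemma Cder_minus (f g : C -> C) (z a b : C) :
  Cder f z a -> Cder g z b -> Cder (fun w => f w - g w)%C z (a - b)%C.
Proof. intros; apply Cder_plus; [assumption|now apply Cder_opp]. Qed.

Lemma Cder_mult (f g : C -> C) (z a b : C) :
  Cder f z a -> Cder g z b -> Cder (fun w => f w * g w)%C z (a * g z + f z * b)%C.
Proof.
rewrite !Cder_is_derive_ring. intros. apply @is_derive_mult; auto.
intros; apply Cmult_comm.
Qed.

Lemma Cder_comp (f g : C -> C) (z a b : C) :
  Cder f (g z) a -> Cder g z b -> Cder (fun w => f (g w)) z (a * b)%C.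
Proof.
rewrite !Cder_is_derive_ring. intros. rewrite Cmult_comm.
now apply (@is_derive_comp C_AbsRing (AbsRing_NormedModule C_AbsRing)).
Qed.

Lemma Cder_unique (f : C -> C) (z a b : C) : Cder f z a -> Cder f z b -> a = b.
Proof.
rewrite !Cder_is_derive. intros H1 H2.
now rewrite <- (is_C_derive_unique _ _ _ H1), <- (is_C_derive_unique _ _ _ H2).
Qed.

Definition Ccont (f : C -> C) (z : C) : Prop :=
  forall eps, 0 < eps -> exists del, 0 < del /\
    forall w, Cmod (w - z) < del -> Cmod (f w - f z) < eps.

Lemma Cder_cont (f : C -> C) (z l : C) : Cder f z l -> Ccont f z.
Proof.
intros H eps He. destruct (H 1 Rlt_0_1) as [d [Hd Hw]].
assert (HL := Cmod_ge_0 l).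
assert (Hp : 0 < eps / (2 + Cmod l)) by (apply Rdiv_lt_0_compat; lra).
exists (Rmin d (eps / (2 + Cmod l))); split; [apply Rmin_pos; lra|]; intros w H1.
assert (H2 : Cmod (w - z) < d) by exact (Rlt_le_trans _ _ _ H1 (Rmin_l _ _)).
assert (H3 : Cmod (w - z) < eps / (2 + Cmod l)) by exact (Rlt_le_trans _ _ _ H1 (Rmin_r _ _)).
specialize (Hw w H2).
replace (f w - f z)%C with ((f w - f z - l * (w - z)) + l * (w - z))%C by ring.
eapply Rle_lt_trans; [apply Cmod_triangle|]. rewrite Cmod_mult.
apply Rmult_lt_compat_r with (r := 2 + Cmod l) in H3; [|lra].
replace (eps / (2 + Cmod l) * (2 + Cmod l)) with eps in H3 by (field; lra).
generalize (Cmod_ge_0 (w - z)); nra.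
Qed.

(** The exact remainder is [(w - z)^2 / (w z^2)], and [|w| > |z| / 2] near [z]. *)
Lemma Cder_inv (z : C) : z <> 0%C -> Cder Cinv z (- / (z * z))%C.
Proof.
intros Hz eps He. assert (Hm := proj1 (Cmod_gt_0 z) Hz). set (m := Cmod z) in *.
exists (Rmin (m / 2) (eps * m ^ 3 / 2)); split.
{ apply Rmin_pos; [lra|]. assert (0 < m ^ 3) by (apply pow_lt; lra). nra. }
intros w H1.
assert (H2 : Cmod (w - z) < m / 2) by exact (Rlt_le_trans _ _ _ H1 (Rmin_l _ _)).
assert (H3 : Cmod (w - z) < eps * m ^ 3 / 2) by exact (Rlt_le_trans _ _ _ H1 (Rmin_r _ _)).
assert (Hw : m / 2 < Cmod w).
{ assert (T := Cmod_triangle w (- (w - z))).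
  replace (w + - (w - z))%C with z in T by ring. rewrite Cmod_opp in T. fold m in T. lra. }
assert (Hw0 : w <> 0%C) by (intros ->; rewrite Cmod_0 in Hw; lra).
replace (/ w - / z - - / (z * z) * (w - z))%C with ((w - z) * (w - z) * / (w * (z * z)))%C
  by (field; auto).
rewrite !Cmod_mult, Cmod_inv, !Cmod_mult.
2:{ repeat apply Cmult_neq_0; auto. }
fold m. set (d := Cmod (w - z)) in *. assert (0 <= d) by apply Cmod_ge_0.
apply Rle_trans with (d * d * / (m / 2 * (m * m))).
- apply Rmult_le_compat_l; [nra|]. apply Rinv_le_contravar; nra.
- replace (d * d * / (m / 2 * (m * m))) with (d * (d * 2 / m ^ 3)) by (field; lra).
  rewrite (Rmult_comm eps). apply Rmult_le_compat_l; [lra|].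
  assert (0 < m ^ 3) by (apply pow_lt; lra).
  apply Rmult_le_reg_r with (m ^ 3); [lra|].
  replace (d * 2 / m ^ 3 * m ^ 3) with (d * 2) by (field; lra). lra.
Qed.

Lemma Cder_pow (n : nat) (z : C) : Cder (fun w => w ^ S n)%C z (INR (S n) * z ^ n)%C.
Proof.
induction n as [|n IH].
- replace (RtoC (INR 1) * z ^ 0)%C with (RtoC 1) by (simpl; ring).
  apply (Cder_ext_loc (fun w => w) _ _ _ 1 Rlt_0_1); [intros; simpl; ring|apply Cder_id].
- replace (RtoC (INR (S (S n))) * z ^ S n)%C with (1 * z ^ S n + z * (INR (S n) * z ^ n))%C.
  { exact (Cder_mult (fun w => w) (fun w => w ^ S n)%C z _ _ (Cder_id z) IH). }
  rewrite (S_INR (S n)), RtoC_plus, !Cpow_S. ring.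
Qed.

(** * Derivatives along real paths *)

(** Restricting a holomorphic function to a path reduces global statements on the
    disk to the one-variable mean value theorem or to a Riemann integral. *)
Definition Rder (c : R -> C) (t : R) (v : C) : Prop :=
  is_derive (fun u => Re (c u)) t (Re v) /\ is_derive (fun u => Im (c u)) t (Im v).

Lemma Cmod_le_abs (z : C) : Cmod z <= Rabs (Re z) + Rabs (Im z).
Proof.
assert (Ha := Rabs_pos (Re z)); assert (Hb := Rabs_pos (Im z)).
apply Rsqr_incr_0; [|apply Cmod_ge_0|lra].
unfold Rsqr. rewrite <- (Rmult_1_r (Cmod z)) at 2.
replace (Cmod z * (Cmod z * 1)) with (Cmod z ^ 2) by ring.
rewrite Cmod2_alt, <- (pow2_abs (Re z)), <- (pow2_abs (Im z)). nra.
Qed.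

Lemma im_le_Cmod (z : C) : Rabs (Im z) <= Cmod z.
Proof. eapply Rle_trans; [|apply Rmax_Cmod]. apply Rmax_r. Qed.

Lemma is_derive_eps (f : R -> R) (x l : R) :
  is_derive f x l <->
  forall eps, 0 < eps -> exists del, 0 < del /\
    forall y, Rabs (y - x) < del -> Rabs (f y - f x - l * (y - x)) <= eps * Rabs (y - x).
Proof.
split.
- intros [_ H] eps He.
  destruct (H x (fun P HP => HP) (mkposreal eps He)) as [d Hw].
  exists d; split; [apply cond_pos|]; intros w Bw.
  specialize (Hw w Bw). rewrite Rmult_comm. exact Hw.
- intros H; split; [apply is_linear_scal_l|].
  intros y Hy eps. apply (@is_filter_lim_locally_unique R_AbsRing (AbsRing_NormedModule R_AbsRing)) in Hy; rewrite <- Hy; clear y Hy.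
  destruct (H eps (cond_pos eps)) as [d [Hd Hw]].
  exists (mkposreal d Hd); intros w Bw.
  specialize (Hw w Bw). rewrite Rmult_comm in Hw. exact Hw.
Qed.

(** The chain rule with a holomorphic outer function is an estimate on [Cmod],
    not on the two components. *)
Lemma Rder_eps (c : R -> C) (t : R) (v : C) :
  Rder c t v <->
  forall eps, 0 < eps -> exists del, 0 < del /\
    forall u, Rabs (u - t) < del -> Cmod (c u - c t - v * RtoC (u - t)) <= eps * Rabs (u - t).
Proof.
assert (ER : forall u, Re (c u - c t - v * RtoC (u - t)) = Re (c u) - Re (c t) - Re v * (u - t))
  by (intros; unfold Re; simpl; ring).
assert (EI : forall u, Im (c u - c t - v * RtoC (u - t)) = Im (c u) - Im (c t) - Im v * (u - t))
  by (intros; unfold Im; simpl; ring).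
unfold Rder; rewrite !is_derive_eps; split.
- intros [H1 H2] eps He.
  destruct (H1 (eps / 2)) as [d1 [Hd1 W1]]; [lra|].
  destruct (H2 (eps / 2)) as [d2 [Hd2 W2]]; [lra|].
  exists (Rmin d1 d2); split; [apply Rmin_pos; lra|]; intros u Hu.
  eapply Rle_trans; [apply Cmod_le_abs|]. rewrite ER, EI.
  assert (A := W1 u (Rlt_le_trans _ _ _ Hu (Rmin_l _ _))).
  assert (B := W2 u (Rlt_le_trans _ _ _ Hu (Rmin_r _ _))). lra.
- intros H; split; intros eps He; destruct (H eps He) as [d [Hd W]];
    exists d; split; auto; intros u Hu; specialize (W u Hu).
  + rewrite <- ER. eapply Rle_trans; [apply re_le_Cmod|exact W].
  + rewrite <- EI. eapply Rle_trans; [apply im_le_Cmod|exact W].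
Qed.

Lemma Rder_comp (f : C -> C) (c : R -> C) (t : R) (l v : C) :
  Cder f (c t) l -> Rder c t v -> Rder (fun u => f (c u)) t (l * v)%C.
Proof.
rewrite !Rder_eps. intros Hf Hc eps He.
assert (Hl := Cmod_ge_0 l); assert (Hv := Cmod_ge_0 v).
set (e1 := eps / (2 * (1 + Cmod v))).
assert (He1 : 0 < e1) by (apply Rdiv_lt_0_compat; lra).
set (e2 := Rmin 1 (eps / (2 * (1 + Cmod l)))).
assert (He2 : 0 < e2) by (apply Rmin_pos; [lra|apply Rdiv_lt_0_compat; lra]).
destruct (Hf e1 He1) as [d1 [Hd1 W1]].
destruct (Hc e2 He2) as [d2 [Hd2 W2]].
exists (Rmin d2 (d1 / (1 + Cmod v))); split.
{ apply Rmin_pos; [lra|apply Rdiv_lt_0_compat; lra]. }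
intros u Hu.
assert (Hu2 := W2 u (Rlt_le_trans _ _ _ Hu (Rmin_l _ _))).
assert (Hu1 : Rabs (u - t) * (1 + Cmod v) < d1).
{ apply Rmult_lt_reg_r with (/ (1 + Cmod v)); [apply Rinv_0_lt_compat; lra|].
  rewrite Rmult_assoc, Rinv_r, Rmult_1_r by lra.
  exact (Rlt_le_trans _ _ _ Hu (Rmin_r _ _)). }
assert (Hr := Rabs_pos (u - t)). set (r := Rabs (u - t)) in *.
assert (e2 <= 1) by apply Rmin_l.
assert (He2' : e2 * Cmod l <= eps / 2).
{ apply Rle_trans with (eps / (2 * (1 + Cmod l)) * Cmod l).
  - apply Rmult_le_compat_r; [lra|apply Rmin_r].
  - apply Rmult_le_reg_r with (2 * (1 + Cmod l)); [lra|].
    replace (eps / (2 * (1 + Cmod l)) * Cmod l * (2 * (1 + Cmod l))) with (eps * Cmod l) by (field; lra).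
    nra. }
assert (Hdc : Cmod (c u - c t) <= r * (1 + Cmod v)).
{ replace (c u - c t)%C with ((c u - c t - v * RtoC (u - t)) + v * RtoC (u - t))%C by ring.
  eapply Rle_trans; [apply Cmod_triangle|]. rewrite Cmod_mult, Cmod_R. fold r. nra. }
assert (Hf1 := W1 (c u) (Rle_lt_trans _ _ _ Hdc Hu1)).
replace (f (c u) - f (c t) - l * v * RtoC (u - t))%C with
  ((f (c u) - f (c t) - l * (c u - c t)) + l * (c u - c t - v * RtoC (u - t)))%C by ring.
eapply Rle_trans; [apply Cmod_triangle|]. rewrite Cmod_mult.
assert (e1 * Cmod (c u - c t) <= eps / 2 * r).
{ apply Rle_trans with (e1 * (r * (1 + Cmod v))); [apply Rmult_le_compat_l; lra|].
  right; unfold e1; field; lra. }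
assert (Cmod l * Cmod (c u - c t - v * RtoC (u - t)) <= Cmod l * (e2 * r))
  by (apply Rmult_le_compat_l; lra).
nra.
Qed.

Lemma Rder_ray (z0 z : C) (t : R) : Rder (fun u => z0 + RtoC u * z)%C t z.
Proof.
split.
- apply is_derive_ext with (fun u => Re z0 + u * Re z).
  { intros; unfold Re; simpl; ring. }
  auto_derive; auto; ring.
- apply is_derive_ext with (fun u => Im z0 + u * Im z).
  { intros; unfold Im; simpl; ring. }
  auto_derive; auto; ring.
Qed.

(** * Exponential, logarithm and the functions q_s *)

Lemma Cexp_plus (z w : C) : Cexp (z + w) = (Cexp z * Cexp w)%C.
Proof.
destruct z as [a b], w as [c d]; unfold Cexp, Cmult, Re, Im; simpl.
rewrite exp_plus, cos_plus, sin_plus. f_equal; ring.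
Qed.

Lemma Cexp_0 : Cexp 0 = 1%C.
Proof. unfold Cexp, Re, Im; simpl. rewrite exp_0, cos_0, sin_0. unfold RtoC; f_equal; ring. Qed.

Lemma Cmod_Cexp (z : C) : Cmod (Cexp z) = exp (Re z).
Proof.
assert (H := exp_pos (Re z)).
apply Rsqr_inj; [apply Cmod_ge_0|lra|].
rewrite !Rsqr_pow2, Cmod2_alt. unfold Cexp, Re, Im; simpl.
generalize (sin2_cos2 (snd z)); unfold Rsqr; intros E. nra.
Qed.

Lemma Cexp_nz (z : C) : Cexp z <> 0%C.
Proof. intros H; apply (f_equal Cmod) in H. rewrite Cmod_Cexp, Cmod_0 in H. generalize (exp_pos (Re z)); lra. Qed.

(** The remainder at 0 is a combination of the first-order remainders of the
    real functions exp, cos and sin; other points follow from [Cexp_plus]. *)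
Lemma Cder_Cexp_0 : Cder Cexp 0 1.
Proof.
intros eps He.
assert (D1 : is_derive exp 0 1) by (rewrite <- exp_0; apply is_derive_exp).
assert (D2 : is_derive cos 0 0) by (auto_derive; auto; rewrite sin_0; ring).
assert (D3 : is_derive sin 0 1) by (auto_derive; auto; rewrite cos_0; ring).
rewrite is_derive_eps in D1, D2, D3.
set (e := Rmin 1 (eps / 10)).
assert (Hep : 0 < e) by (apply Rmin_pos; lra).
assert (e <= 1) by apply Rmin_l. assert (e <= eps / 10) by apply Rmin_r.
destruct (D1 e Hep) as [d1 [Hd1 W1]].
destruct (D2 e Hep) as [d2 [Hd2 W2]].
destruct (D3 e Hep) as [d3 [Hd3 W3]].
set (d := Rmin (Rmin d1 d2) (Rmin d3 e)).
assert (L1 : d <= d1) by (eapply Rle_trans; [apply Rmin_l|apply Rmin_l]).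
assert (L2 : d <= d2) by (eapply Rle_trans; [apply Rmin_l|apply Rmin_r]).
assert (L3 : d <= d3) by (eapply Rle_trans; [apply Rmin_r|apply Rmin_l]).
assert (L4 : d <= e) by (eapply Rle_trans; [apply Rmin_r|apply Rmin_r]).
exists d; split; [repeat apply Rmin_pos; lra|].
intros [x y]. replace ((x, y) - 0)%C with ((x, y) : C)
  by (unfold RtoC, Cminus, Cplus, Copp; simpl; f_equal; ring). intros Hw.
assert (Hx := re_le_Cmod (x, y)); assert (Hy := im_le_Cmod (x, y)).
unfold Re, Im in Hx, Hy; simpl in Hx, Hy.
set (r := Cmod (x, y)) in *.
specialize (W1 x); specialize (W2 y); specialize (W3 y).
rewrite Rminus_0_r in W1, W2, W3. rewrite exp_0 in W1. rewrite cos_0 in W2. rewrite sin_0 in W3.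
assert (A1 : Rabs (exp x - 1 - 1 * x) <= e * Rabs x) by (apply W1; lra).
assert (A2 : Rabs (cos y - 1 - 0 * y) <= e * Rabs y) by (apply W2; lra).
assert (A3 : Rabs (sin y - 0 - 1 * y) <= e * Rabs y) by (apply W3; lra).
rewrite Cexp_0. eapply Rle_trans; [apply Cmod_le_abs|].
unfold Cexp, Re, Im; simpl.
set (X := exp x - 1 - 1 * x) in *. set (Y := cos y - 1 - 0 * y) in *. set (Z := sin y - 0 - 1 * y) in *.
replace (exp x * cos y + - (1) + - (1 * x - 0 * y)) with (X + exp x * Y) by (unfold X, Y; ring).
replace (exp x * sin y + - 0 + - (1 * y + 0 * x)) with (exp x * Z + (X + x) * y) by (unfold X, Z; ring).
assert (Hex : exp x <= 3).
{ replace (exp x) with (X + 1 + x) by (unfold X; ring). generalize (Rle_abs X) (Rle_abs x) (Rabs_pos x). nra. }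
assert (0 < exp x) by apply exp_pos.
assert (B1 := Rabs_triang X (exp x * Y)).
assert (B2 := Rabs_triang (exp x * Z) ((X + x) * y)).
assert (B3 := Rabs_triang X x).
rewrite !Rabs_mult, (Rabs_pos_eq (exp x)) in * by lra.
assert (P1 := Rabs_pos x). assert (P2 := Rabs_pos y). assert (P3 := Rabs_pos Y). assert (P4 := Rabs_pos Z).
assert (P5 := Rabs_pos X). assert (P6 := Rabs_pos (X + x)).
assert (exp x * Rabs Y <= 3 * (e * r)) by (apply Rmult_le_compat; nra).
assert (exp x * Rabs Z <= 3 * (e * r)) by (apply Rmult_le_compat; nra).
assert (Rabs (X + x) * Rabs y <= 2 * e * r) by (apply Rmult_le_compat; nra).
nra.
Qed.

Lemma Cder_Cexp (z : C) : Cder Cexp z (Cexp z).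
Proof.
assert (H0 : Cder (fun w => w - z)%C z 1%C).
{ replace (RtoC 1) with (1 - 0)%C by ring. apply Cder_minus; [apply Cder_id|apply Cder_const]. }
assert (H1 : Cder (fun w => Cexp (w - z)) z (1 * 1)%C).
{ apply (Cder_comp Cexp (fun w => w - z)%C); auto. replace (z - z)%C with (RtoC 0) by ring. apply Cder_Cexp_0. }
assert (H2 := Cder_mult _ _ _ _ _ (Cder_const (Cexp z) z) H1).
replace (Cexp z) with (0 * Cexp (z - z) + Cexp z * (1 * 1))%C by ring.
revert H2; apply (Cder_ext_loc _ _ _ _ 1); [lra|]. intros w _. simpl.
rewrite <- Cexp_plus. f_equal; ring.
Qed.

Lemma Ccont_Cln (w : C) : 0 < Re w -> Ccont Cln w.
Proof.
intros Hw eps He.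
assert (C1 : continuous ln (Cmod w)).
{ apply @ex_derive_continuous. exists (/ Cmod w). apply is_derive_ln.
  assert (T1 := re_le_Cmod w); assert (T2 := Rle_abs (Re w)). lra. }
assert (C2 : continuous (fun z : C => Im z / Re z) w).
{ apply (continuous_mult (fun z : C => Im z) (fun z : C => / Re z)).
  - apply continuous_snd.
  - apply continuous_comp; [apply continuous_fst|].
    apply @ex_derive_continuous. auto_derive. apply Rgt_not_eq, Hw. }
assert (C3 : continuous (fun z : C => atan (Im z / Re z)) w).
{ apply (continuous_comp (fun z : C => Im z / Re z) atan); auto.
  apply @ex_derive_continuous. eexists; apply is_derive_atan. }
assert (He2 : 0 < eps / 2) by lra.
destruct (proj1 (filterlim_locally ln (ln (Cmod w))) C1 (mkposreal _ He2)) as [d1 W1].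
assert (C3' := proj1 (filterlim_locally (fun z : C => atan (Im z / Re z)) _) C3 (mkposreal _ He2)).
destruct C3' as [d2 W2].
exists (Rmin d1 d2); split; [apply Rmin_pos; apply cond_pos|]; intros z Hz.
assert (Hz1 := Rlt_le_trans _ _ _ Hz (Rmin_l _ _)).
assert (Hz2 := Rlt_le_trans _ _ _ Hz (Rmin_r _ _)).
eapply Rle_lt_trans; [apply Cmod_le_abs|]. unfold Cln; simpl.
assert (A : Rabs (ln (Cmod z) - ln (Cmod w)) < eps / 2).
{ apply (W1 (Cmod z)). unfold ball; simpl; unfold AbsRing_ball, abs, minus, plus, opp; simpl.
  eapply Rle_lt_trans; [|exact Hz1].
  assert (T1 := Cmod_triangle (z - w) w). replace (z - w + w)%C with z in T1 by ring.
  assert (T2 := Cmod_triangle (- (z - w)) z). replace (- (z - w) + z)%C with w in T2 by ring.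
  rewrite Cmod_opp in T2. apply Rabs_le; lra. }
assert (B : Rabs (atan (Im z / Re z) - atan (Im w / Re w)) < eps / 2).
{ apply (W2 z). apply C_NormedModule_mixin_compat1. exact Hz2. }
change (Rabs (ln (Cmod z) - ln (Cmod w)) + Rabs (atan (Im z / Re z) - atan (Im w / Re w)) < eps).
lra.
Qed.

(** [Cln] is a continuous right inverse of [Cexp], so the first-order expansion
    of [Cexp] at [Cln w] can be solved for the increment of [Cln]. *)
Lemma Cder_Cln (w : C) : 0 < Re w -> Cder Cln w (/ w)%C.
Proof.
intros Hw eps He.
assert (Hw0 : w <> 0%C) by (intros ->; simpl in Hw; unfold Re in Hw; simpl in Hw; lra).
assert (Hm := proj1 (Cmod_gt_0 w) Hw0). set (m := Cmod w) in *.
set (e := Rmin (m / 2) (eps * (m * m) / 2)).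
assert (He1 : 0 < e) by (apply Rmin_pos; [lra|]; assert (0 < m * m) by nra; nra).
assert (e <= m / 2) by apply Rmin_l. assert (e <= eps * (m * m) / 2) by apply Rmin_r.
destruct (Cder_Cexp (Cln w) e He1) as [d1 [Hd1 W1]].
destruct (Ccont_Cln w Hw d1 Hd1) as [d2 [Hd2 W2]].
exists (Rmin d2 (Re w)); split; [apply Rmin_pos; lra|]; intros z Hz.
assert (Hz1 := Rlt_le_trans _ _ _ Hz (Rmin_l _ _)).
assert (Hz2 := Rlt_le_trans _ _ _ Hz (Rmin_r _ _)).
assert (Rz : 0 < Re z).
{ assert (T := re_le_Cmod (z - w)). unfold Re in *; simpl in *.
  destruct (Rabs_def2 (fst z + - fst w) (fst w)); lra. }
specialize (W1 _ (W2 z Hz1)). rewrite !Cexp_Cln in W1 by assumption.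
set (k := (Cln z - Cln w)%C) in *. set (dl := (z - w)%C) in *.
replace (k - / w * dl)%C with (- (/ w) * (dl - w * k))%C by (field; auto).
rewrite Cmod_mult, Cmod_opp, Cmod_inv by auto. fold m.
assert (Hk : m * Cmod k <= 2 * Cmod dl).
{ assert (T := Cmod_triangle (- (dl - w * k)) dl).
  replace (- (dl - w * k) + dl)%C with (w * k)%C in T by ring.
  rewrite Cmod_opp, Cmod_mult in T. fold m in T. generalize (Cmod_ge_0 k); nra. }
apply Rmult_le_reg_l with (m * m); [nra|].
replace (m * m * (/ m * Cmod (dl - w * k))) with (m * Cmod (dl - w * k)) by (field; lra).
apply Rle_trans with (m * (e * Cmod k)); [apply Rmult_le_compat_l; lra|].
apply Rle_trans with (e * (2 * Cmod dl)); [generalize (Cmod_ge_0 k); nra|].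
generalize (Cmod_ge_0 dl); nra.
Qed.

Lemma disk_Re_1m_pos (z : C) : in_disk z -> 0 < Re (1 - z).
Proof.
unfold in_disk; intros H. assert (T := re_le_Cmod z).
unfold Re in *; simpl. generalize (Rle_abs (fst z)); lra.
Qed.

Lemma disk_1m_neq_0 (z : C) : in_disk z -> (1 - z <> 0)%C.
Proof. intros H E. apply disk_Re_1m_pos in H. rewrite E in H. unfold Re in H; simpl in H; lra. Qed.

Lemma Cder_Cln_1m (z : C) : in_disk z -> Cder (fun w => Cln (1 - w)) z (- / (1 - z))%C.
Proof.
intros Hz. replace (- / (1 - z))%C with (/ (1 - z) * (0 - 1))%C by (field; now apply disk_1m_neq_0).
apply (Cder_comp Cln (fun w => 1 - w)%C).
- apply Cder_Cln, disk_Re_1m_pos, Hz.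
- apply Cder_minus; [apply Cder_const|apply Cder_id].
Qed.

Lemma Cder_q (s : R) (z : C) : in_disk z -> Cder (q s) z (s * q s z / (1 - z))%C.
Proof.
intros Hz.
replace (s * q s z / (1 - z))%C
  with (Cexp (- (RtoC s * Cln (1 - z))) * (- (0 * Cln (1 - z) + RtoC s * - / (1 - z))))%C
  by (unfold q; field; now apply disk_1m_neq_0).
apply (Cder_comp Cexp (fun w => - (RtoC s * Cln (1 - w)))%C); [apply Cder_Cexp|].
apply Cder_opp. apply (Cder_mult (fun _ => RtoC s) (fun w => Cln (1 - w))); [apply Cder_const|].
now apply Cder_Cln_1m.
Qed.

Lemma q_nz (s : R) (z : C) : q s z <> 0%C.
Proof. apply Cexp_nz. Qed.

(** * Absolutely convergent complex series *)

Definition CS (u : nat -> C) : C := (Series (fun n => Re (u n)), Series (fun n => Im (u n))).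

Definition abs_conv (u : nat -> C) : Prop := ex_series (fun n => Cmod (u n)).

Lemma is_series_C (u : nat -> C) (l : C) :
  @is_series C_AbsRing C_NormedModule u l <->
  is_series (fun n => Re (u n)) (Re l) /\ is_series (fun n => Im (u n)) (Im l).
Proof.
assert (S1 : forall n, Re (@sum_n C_NormedModule u n) = sum_n (fun n => Re (u n)) n).
{ induction n; [rewrite !sum_O|rewrite !sum_Sn, <- IHn]; reflexivity. }
assert (S2 : forall n, Im (@sum_n C_NormedModule u n) = sum_n (fun n => Im (u n)) n).
{ induction n; [rewrite !sum_O|rewrite !sum_Sn, <- IHn]; reflexivity. }
split.
- intros H; split.
  + unfold is_series. apply filterlim_ext with (1 := S1).
    eapply filterlim_comp; [exact H|]. exact (continuous_fst (fst l) (snd l)).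
  + unfold is_series. apply filterlim_ext with (1 := S2).
    eapply filterlim_comp; [exact H|]. exact (continuous_snd (fst l) (snd l)).
- intros [H1 H2]. unfold is_series in *.
  apply (proj2 (filterlim_locally _ _)). intros eps.
  destruct (proj1 (filterlim_locally _ _) H1 eps) as [N1 W1].
  destruct (proj1 (filterlim_locally _ _) H2 eps) as [N2 W2].
  exists (max N1 N2); intros n Hn; split.
  + specialize (W1 n ltac:(lia)). rewrite <- S1 in W1. exact W1.
  + specialize (W2 n ltac:(lia)). rewrite <- S2 in W2. exact W2.
Qed.

Lemma abs_conv_Re (u : nat -> C) : abs_conv u -> ex_series (fun n => Rabs (Re (u n))).
Proof.
intros H. apply (@ex_series_le R_AbsRing R_CompleteNormedModule) with (2 := H).
intros n. change (Rabs (Rabs (Re (u n))) <= Cmod (u n)). rewrite Rabs_Rabsolu. apply re_le_Cmod.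
Qed.

Lemma abs_conv_Im (u : nat -> C) : abs_conv u -> ex_series (fun n => Rabs (Im (u n))).
Proof.
intros H. apply (@ex_series_le R_AbsRing R_CompleteNormedModule) with (2 := H).
intros n. change (Rabs (Rabs (Im (u n))) <= Cmod (u n)). rewrite Rabs_Rabsolu. apply im_le_Cmod.
Qed.

Lemma CS_Re (u : nat -> C) : abs_conv u -> is_series (fun n => Re (u n)) (Re (CS u)).
Proof. intros H. apply Series_correct, ex_series_Rabs, abs_conv_Re, H. Qed.

Lemma CS_Im (u : nat -> C) : abs_conv u -> is_series (fun n => Im (u n)) (Im (CS u)).
Proof. intros H. apply Series_correct, ex_series_Rabs, abs_conv_Im, H. Qed.

Lemma CS_unique (u : nat -> C) (l : C) :
  is_series (fun n => Re (u n)) (Re l) -> is_series (fun n => Im (u n)) (Im l) -> CS u = l.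
Proof.
intros H1 H2. unfold CS. rewrite (is_series_unique _ _ H1), (is_series_unique _ _ H2).
destruct l; reflexivity.
Qed.

Lemma CS_ext (u v : nat -> C) : (forall n, u n = v n) -> CS u = CS v.
Proof. intros H; unfold CS; f_equal; apply Series_ext; intros; now rewrite H. Qed.

Lemma abs_conv_le (u : nat -> C) (v : nat -> R) :
  (forall n, Cmod (u n) <= v n) -> ex_series v -> abs_conv u.
Proof.
intros H. apply (@ex_series_le R_AbsRing R_CompleteNormedModule).
intros n. change (Rabs (Cmod (u n)) <= v n). rewrite Rabs_pos_eq by apply Cmod_ge_0. apply H.
Qed.

Lemma CS_plus (u v : nat -> C) :
  abs_conv u -> abs_conv v -> CS (fun n => u n + v n)%C = (CS u + CS v)%C.
Proof.
intros Hu Hv. apply CS_unique.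
- exact (is_series_plus _ _ _ _ (CS_Re u Hu) (CS_Re v Hv)).
- exact (is_series_plus _ _ _ _ (CS_Im u Hu) (CS_Im v Hv)).
Qed.

Lemma CS_scal (c : C) (u : nat -> C) :
  abs_conv u -> CS (fun n => c * u n)%C = (c * CS u)%C.
Proof.
intros Hu. apply CS_unique.
- apply is_series_ext with (fun n => minus (scal (Re c) (Re (u n))) (scal (Im c) (Im (u n)))).
  { reflexivity. }
  apply (is_series_minus (fun n => scal (Re c) (Re (u n))) (fun n => scal (Im c) (Im (u n)))
           (scal (Re c) (Re (CS u))) (scal (Im c) (Im (CS u))));
  apply @is_series_scal; [apply CS_Re|apply CS_Im]; assumption.
- apply is_series_ext with (fun n => plus (scal (Re c) (Im (u n))) (scal (Im c) (Re (u n)))).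
  { reflexivity. }
  apply (is_series_plus (fun n => scal (Re c) (Im (u n))) (fun n => scal (Im c) (Re (u n)))
           (scal (Re c) (Im (CS u))) (scal (Im c) (Re (CS u))));
  apply @is_series_scal; [apply CS_Im|apply CS_Re]; assumption.
Qed.

Lemma abs_conv_plus (u v : nat -> C) :
  abs_conv u -> abs_conv v -> abs_conv (fun n => u n + v n)%C.
Proof.
intros Hu Hv. apply abs_conv_le with (fun n => Cmod (u n) + Cmod (v n)).
- intros; apply Cmod_triangle.
- exact (ex_series_plus _ _ Hu Hv).
Qed.

Lemma abs_conv_scal (c : C) (u : nat -> C) : abs_conv u -> abs_conv (fun n => c * u n)%C.
Proof.
intros Hu. apply abs_conv_le with (fun n => Cmod c * Cmod (u n)).
- intros; rewrite Cmod_mult; lra.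
- exact (ex_series_scal (Cmod c) _ Hu).
Qed.

Lemma CS_incr_1 (u : nat -> C) :
  abs_conv u -> CS u = (u 0%nat + CS (fun n => u (S n)))%C.
Proof.
intros H. unfold CS at 1. rewrite (Series_incr_1 (fun n => Re (u n))), (Series_incr_1 (fun n => Im (u n))).
- unfold CS, Cplus; simpl. reflexivity.
- apply ex_series_Rabs, abs_conv_Im, H.
- apply ex_series_Rabs, abs_conv_Re, H.
Qed.

Lemma abs_conv_incr_1 (u : nat -> C) : abs_conv u <-> abs_conv (fun n => u (S n)).
Proof. apply (ex_series_incr_1 (fun n => Cmod (u n))). Qed.

(** The factor 2 pays for treating the two components separately; only the
    order of magnitude is used. *)
Lemma CS_bound (u : nat -> C) : abs_conv u -> Cmod (CS u) <= 2 * Series (fun n => Cmod (u n)).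
Proof.
intros H. eapply Rle_trans; [apply Cmod_le_abs|].
assert (A : Rabs (Re (CS u)) <= Series (fun n => Cmod (u n))).
{ eapply Rle_trans; [apply Series_Rabs, abs_conv_Re, H|].
  apply Series_le; [|exact H]. intros; split; [apply Rabs_pos|apply re_le_Cmod]. }
assert (B : Rabs (Im (CS u)) <= Series (fun n => Cmod (u n))).
{ eapply Rle_trans; [apply Series_Rabs, abs_conv_Im, H|].
  apply Series_le; [|exact H]. intros; split; [apply Rabs_pos|apply im_le_Cmod]. }
lra.
Qed.

Fixpoint csum (u : nat -> C) (n : nat) : C :=
  match n with O => u 0%nat | S k => (csum u k + u (S k))%C end.

Lemma Re_csum (u : nat -> C) (n : nat) : Re (csum u n) = sum_f_R0 (fun k => Re (u k)) n.
Proof. induction n as [|n IH]; simpl; [reflexivity|rewrite <- IH; reflexivity]. Qed.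

Lemma Im_csum (u : nat -> C) (n : nat) : Im (csum u n) = sum_f_R0 (fun k => Im (u k)) n.
Proof. induction n as [|n IH]; simpl; [reflexivity|rewrite <- IH; reflexivity]. Qed.

(** Four real Cauchy products, one for each pairing of components. *)
Lemma CS_mult (u v : nat -> C) :
  abs_conv u -> abs_conv v ->
  CS (fun n => csum (fun k => u k * v (n - k)%nat)%C n) = (CS u * CS v)%C.
Proof.
intros Hu Hv.
assert (E : forall (x y : nat -> R) X Y, is_series x X -> is_series y Y ->
   ex_series (fun n => Rabs (x n)) -> ex_series (fun n => Rabs (y n)) ->
   is_series (fun n => sum_f_R0 (fun k => x k * y (n - k)%nat) n) (X * Y))
  by (intros; now apply is_series_mult).
assert (A1 := CS_Re u Hu). assert (A2 := CS_Im u Hu). assert (A3 := CS_Re v Hv). assert (A4 := CS_Im v Hv).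
assert (B1 := abs_conv_Re u Hu). assert (B2 := abs_conv_Im u Hu). assert (B3 := abs_conv_Re v Hv). assert (B4 := abs_conv_Im v Hv).
apply CS_unique.
- apply is_series_ext with (fun n => minus
    (sum_f_R0 (fun k => Re (u k) * Re (v (n - k)%nat)) n)
    (sum_f_R0 (fun k => Im (u k) * Im (v (n - k)%nat)) n)).
  { intros n. rewrite Re_csum. unfold minus, plus, opp; simpl.
    symmetry; apply minus_sum. }
  exact (is_series_minus _ _ _ _ (E _ _ _ _ A1 A3 B1 B3) (E _ _ _ _ A2 A4 B2 B4)).
- apply is_series_ext with (fun n => plus
    (sum_f_R0 (fun k => Re (u k) * Im (v (n - k)%nat)) n)
    (sum_f_R0 (fun k => Im (u k) * Re (v (n - k)%nat)) n)).
  { intros n. rewrite Im_csum. unfold plus; simpl. symmetry; apply plus_sum. }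
  exact (is_series_plus _ _ _ _ (E _ _ _ _ A1 A4 B1 B4) (E _ _ _ _ A2 A3 B2 B3)).
Qed.

(** * Power series on the unit disk *)

Definition PS (a : nat -> C) (z : C) : C := CS (fun n => a n * z ^ n)%C.

(** Radius of convergence at least 1. Boundedness, unlike convergence, passes to
    shifted and differentiated coefficients by elementary estimates, and it
    implies absolute convergence at every smaller radius. *)
Definition disk_coeffs (a : nat -> C) : Prop :=
  forall r, 0 <= r < 1 -> exists M, forall n, Cmod (a n) * r ^ n <= M.

Lemma ex_series_geom_majorant (r x : R) (M : R) (c : nat -> R) :
  0 <= r < x -> (forall n, 0 <= c n * x ^ n <= M) -> ex_series (fun n => c n * r ^ n).
Proof.
intros Hr H.
apply (@ex_series_le R_AbsRing R_CompleteNormedModule) with (fun n => M * (r / x) ^ n).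
- intros n. change (Rabs (c n * r ^ n) <= M * (r / x) ^ n).
  assert (Hx : 0 < x ^ n) by (apply pow_lt; lra).
  assert (Hrn : 0 <= (r / x) ^ n).
  { apply pow_le. apply Rmult_le_pos; [lra|]. left; apply Rinv_0_lt_compat; lra. }
  replace (c n * r ^ n) with ((c n * x ^ n) * (r / x) ^ n).
  + rewrite Rabs_pos_eq; [|apply Rmult_le_pos; [apply H|exact Hrn]].
    apply Rmult_le_compat_r; [exact Hrn|apply H].
  + unfold Rdiv. rewrite Rpow_mult_distr, pow_inv. field. lra.
- apply (ex_series_scal M (fun n => (r / x) ^ n)). apply ex_series_geom.
  rewrite Rabs_pos_eq.
  + apply Rmult_lt_reg_r with x; [lra|]. unfold Rdiv; rewrite Rmult_assoc, Rinv_l; lra.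
  + apply Rmult_le_pos; [lra|]. left; apply Rinv_0_lt_compat; lra.
Qed.

Lemma disk_coeffs_real (a : nat -> C) (r : R) :
  disk_coeffs a -> 0 <= r < 1 -> ex_series (fun n => Cmod (a n) * r ^ n).
Proof.
intros H Hr. destruct (H ((1 + r) / 2)) as [M HM]; [lra|].
apply ex_series_geom_majorant with ((1 + r) / 2) M; [lra|]. intros n; split; [|apply HM].
apply Rmult_le_pos; [apply Cmod_ge_0|apply pow_le; lra].
Qed.

Lemma disk_coeffs_abs (a : nat -> C) (z : C) :
  disk_coeffs a -> in_disk z -> abs_conv (fun n => a n * z ^ n)%C.
Proof.
intros H Hz. apply abs_conv_le with (fun n => Cmod (a n) * Cmod z ^ n).
- intros n. rewrite Cmod_mult, Cmod_pow. lra.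
- apply disk_coeffs_real; [exact H|]. split; [apply Cmod_ge_0|exact Hz].
Qed.

(** [(1 - x) (1 + x + ... + x^n) = 1 - x^(n+1)], and each of the [n + 1]
    summands is at least [x^n]. *)
Lemma pow_linear_bound (n : nat) (x : R) :
  0 <= x <= 1 -> INR (S n) * x ^ n * (1 - x) <= 1.
Proof.
intros Hx. apply Rle_trans with (1 - x ^ S n).
- induction n as [|n IH]; [simpl; lra|].
  rewrite S_INR. assert (0 <= x ^ S n) by (apply pow_le; lra).
  change (x ^ S (S n)) with (x * x ^ S n).
  replace ((INR (S n) + 1) * x ^ S n * (1 - x))
    with (x * (INR (S n) * x ^ n * (1 - x)) + x ^ S n * (1 - x)) by (simpl; ring).
  assert (x ^ S n <= 1) by (rewrite <- (pow1 (S n)); apply pow_incr; lra).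
  assert (x * (INR (S n) * x ^ n * (1 - x)) <= x * (1 - x ^ S n)) by (apply Rmult_le_compat_l; lra).
  nra.
- assert (0 <= x ^ S n) by (apply pow_le; lra). lra.
Qed.

(** With [r = x r'] and [r < r' < 1], the factor [x^n] absorbs the linear
    weight. *)
Lemma disk_coeffs_weight (a : nat -> C) :
  disk_coeffs a -> disk_coeffs (fun n => INR (S n) * a n)%C.
Proof.
intros H r Hr. destruct (H ((1 + r) / 2)) as [M HM]; [lra|].
set (r' := (1 + r) / 2) in *. set (x := r / r').
assert (Hr' : r < r' < 1) by (unfold r'; lra).
assert (Hx : 0 <= x < 1).
{ unfold x; split.
  - apply Rmult_le_pos; [lra|]. left; apply Rinv_0_lt_compat; lra.
  - apply Rmult_lt_reg_r with r'; [lra|]. unfold Rdiv; rewrite Rmult_assoc, Rinv_l; lra. }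
assert (HM0 : 0 <= M).
{ eapply Rle_trans; [|apply (HM 0%nat)]. apply Rmult_le_pos; [apply Cmod_ge_0|apply pow_le; lra]. }
exists (M * / (1 - x)). intros n.
rewrite Cmod_mult, Cmod_R, Rabs_pos_eq by apply pos_INR.
replace (INR (S n) * Cmod (a n) * r ^ n) with ((Cmod (a n) * r' ^ n) * (INR (S n) * x ^ n)).
- apply Rmult_le_compat.
  + apply Rmult_le_pos; [apply Cmod_ge_0|apply pow_le; lra].
  + apply Rmult_le_pos; [apply pos_INR|apply pow_le; lra].
  + apply HM.
  + apply Rmult_le_reg_r with (1 - x); [lra|]. rewrite Rinv_l by lra.
    apply pow_linear_bound; lra.
- unfold x, Rdiv. rewrite Rpow_mult_distr, pow_inv. field. apply pow_nonzero; lra.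
Qed.

Lemma disk_coeffs_shift (a : nat -> C) : disk_coeffs a -> disk_coeffs (fun n => a (S n)).
Proof.
intros H r Hr. destruct (Req_dec r 0) as [->|Hr0].
- exists (Cmod (a 1%nat)). intros [|n]; [simpl; lra|].
  rewrite pow_ne_zero by lia. generalize (Cmod_ge_0 (a 1%nat)); lra.
- destruct (H r Hr) as [M HM]. exists (M / r). intros n.
  apply Rmult_le_reg_r with r; [lra|]. replace (M / r * r) with M by (field; lra).
  specialize (HM (S n)). simpl in HM. nra.
Qed.

Definition dseq (a : nat -> C) (n : nat) : C := (INR (S n) * a (S n))%C.

Lemma disk_coeffs_dseq (a : nat -> C) : disk_coeffs a -> disk_coeffs (dseq a).
Proof. intros H. unfold dseq. apply (disk_coeffs_weight (fun n => a (S n))), disk_coeffs_shift, H. Qed.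

(** The remainder for [n + 1] is [w] times the remainder for [n] plus
    [(n + 1) z^n (w - z)^2]. The factor [rho] on the left stands for an
    exponent [n - 1] on the right. *)
Lemma pow_taylor (z w : C) (rho : R) (n : nat) :
  Cmod z <= rho -> Cmod w <= rho ->
  rho * Cmod (w ^ S n - z ^ S n - INR (S n) * z ^ n * (w - z)) <=
  (INR (S n) * INR (S n)) * rho ^ n * Cmod (w - z) ^ 2.
Proof.
intros Hz Hw. assert (Z0 := Cmod_ge_0 z). assert (W0 := Cmod_ge_0 w).
set (d := Cmod (w - z)). assert (Hd : 0 <= d) by apply Cmod_ge_0.
induction n as [|n IH].
- replace (w ^ 1 - z ^ 1 - INR 1 * z ^ 0 * (w - z))%C with (RtoC 0) by (simpl; ring).
  rewrite Cmod_0. simpl. nra.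
- set (E := (w ^ S n - z ^ S n - INR (S n) * z ^ n * (w - z))%C) in *.
  replace (w ^ S (S n) - z ^ S (S n) - INR (S (S n)) * z ^ S n * (w - z))%C
    with (w * E + INR (S n) * z ^ n * ((w - z) * (w - z)))%C.
  2:{ unfold E. rewrite (S_INR (S n)), RtoC_plus, !Cpow_S. ring. }
  eapply Rle_trans; [apply Rmult_le_compat_l; [lra|apply Cmod_triangle]|].
  rewrite !Cmod_mult, Cmod_R, Cmod_pow. fold d.
  rewrite (Rabs_pos_eq (INR (S n))) by apply pos_INR.
  assert (HN : 0 <= INR (S n)) by apply pos_INR.
  assert (Hp : Cmod z ^ n <= rho ^ n) by (apply pow_incr; lra).
  assert (Hr : 0 <= rho ^ n) by (apply pow_le; lra).
  rewrite (S_INR (S n)). set (N := INR (S n)) in *.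
  assert (A : rho * (Cmod w * Cmod E) <= rho * (N * N * rho ^ n * d ^ 2)).
  { apply Rle_trans with (rho * (rho * Cmod E)).
    - apply Rmult_le_compat_l; [lra|]. apply Rmult_le_compat_r; [apply Cmod_ge_0|lra].
    - apply Rmult_le_compat_l; lra. }
  assert (B : rho * (N * Cmod z ^ n * (d * d)) <= rho * (N * rho ^ n * (d * d))).
  { apply Rmult_le_compat_l; [lra|]. apply Rmult_le_compat_r; [nra|]. apply Rmult_le_compat_l; lra. }
  replace ((N + 1) * (N + 1) * rho ^ S n * d ^ 2)
    with (rho * (N * N * rho ^ n * d ^ 2) + rho * (N * rho ^ n * (d * d)) + rho * ((N + 1) * rho ^ n * (d * d)))
    by (simpl; ring).
  assert (0 <= rho * ((N + 1) * rho ^ n * (d * d))).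
  { repeat apply Rmult_le_pos; lra. }
  lra.
Qed.

(** By [pow_taylor] the terms of the difference quotient minus the candidate
    derivative are at most [|w - z|^2] times [n^2 |a_n| rho^n], which is
    summable. *)
Lemma Cder_PS (a : nat -> C) (z : C) :
  disk_coeffs a -> in_disk z -> Cder (PS a) z (PS (dseq a) z).
Proof.
intros Ha Hz eps He. unfold in_disk in Hz. assert (Z0 := Cmod_ge_0 z).
(* Both points stay in a disk of radius [rho < 1], where the bounds are uniform. *)
set (rho := (1 + Cmod z) / 2). assert (Hrho : Cmod z < rho < 1) by (unfold rho; lra).
set (c := fun n => Cmod (INR (S n) * (INR (S n) * a (S n))) * rho ^ n).
assert (Hc : ex_series c).
{ apply (disk_coeffs_real (fun n => INR (S n) * (INR (S n) * a (S n)))%C); [|lra].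
  apply (disk_coeffs_weight (fun n => INR (S n) * a (S n))%C).
  apply (disk_coeffs_weight (fun n => a (S n))), disk_coeffs_shift, Ha. }
assert (Hc0 : forall n, 0 <= c n).
{ intros; apply Rmult_le_pos; [apply Cmod_ge_0|apply pow_le; lra]. }
set (K := Series c).
assert (HK : 0 <= K).
{ unfold K. rewrite <- (Rmult_0_l (Series c)), <- Series_scal_l. apply Series_le; [|exact Hc].
  intros n; specialize (Hc0 n); lra. }
exists (Rmin (rho - Cmod z) (eps * rho / (2 * (K + 1)))); split.
{ apply Rmin_pos; [lra|]. apply Rdiv_lt_0_compat; nra. }
intros w Hw.
assert (Hw1 := Rlt_le_trans _ _ _ Hw (Rmin_l _ _)).
assert (Hw2 := Rlt_le_trans _ _ _ Hw (Rmin_r _ _)).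
assert (Hwr : Cmod w < rho).
{ assert (T := Cmod_triangle (w - z) z). replace (w - z + z)%C with w in T by ring. lra. }
assert (Aw : abs_conv (fun n => a n * w ^ n)%C) by (apply disk_coeffs_abs; [exact Ha|unfold in_disk; lra]).
assert (Az : abs_conv (fun n => a n * z ^ n)%C) by (apply disk_coeffs_abs; [exact Ha|unfold in_disk; lra]).
assert (Ad : abs_conv (fun n => dseq a n * z ^ n)%C).
{ apply disk_coeffs_abs; [apply disk_coeffs_dseq, Ha|exact Hz]. }
assert (Aw' := proj1 (abs_conv_incr_1 _) Aw). assert (Az' := proj1 (abs_conv_incr_1 _) Az).
simpl in Aw', Az'.
set (E := fun n => (a (S n) * (w ^ S n - z ^ S n - INR (S n) * z ^ n * (w - z)))%C).
assert (HE : (PS a w - PS a z - PS (dseq a) z * (w - z))%C = CS E).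
{ unfold PS. rewrite (CS_incr_1 (fun n => a n * w ^ n)%C), (CS_incr_1 (fun n => a n * z ^ n)%C) by assumption.
  transitivity (CS (fun n => a (S n) * w ^ S n) + ((-(1)) * CS (fun n => a (S n) * z ^ S n)
     + (- (w - z)) * CS (fun n => dseq a n * z ^ n)))%C; [simpl; ring|].
  rewrite <- !CS_scal by assumption.
  rewrite <- (CS_plus (fun n => - (1) * (a (S n) * z ^ S n))%C) by (apply abs_conv_scal; assumption).
  rewrite <- CS_plus; [|assumption|apply abs_conv_plus; apply abs_conv_scal; assumption].
  apply CS_ext. intros n. unfold E, dseq. ring. }
rewrite HE.
set (d := Cmod (w - z)) in *. assert (Hd : 0 <= d) by apply Cmod_ge_0.
assert (HEn : forall n, Cmod (E n) <= d ^ 2 / rho * c n).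
{ intros n. unfold E. rewrite Cmod_mult.
  assert (T := pow_taylor z w rho n ltac:(lra) ltac:(lra)). fold d in T.
  set (F := Cmod (w ^ S n - z ^ S n - INR (S n) * z ^ n * (w - z))) in *.
  apply Rmult_le_reg_l with rho; [lra|].
  unfold c. rewrite !Cmod_mult, Cmod_R, Rabs_pos_eq by apply pos_INR.
  replace (rho * (d ^ 2 / rho * (INR (S n) * (INR (S n) * Cmod (a (S n))) * rho ^ n)))
    with (Cmod (a (S n)) * (INR (S n) * INR (S n) * rho ^ n * d ^ 2)) by (field; lra).
  replace (rho * (Cmod (a (S n)) * F)) with (Cmod (a (S n)) * (rho * F)) by ring.
  apply Rmult_le_compat_l; [apply Cmod_ge_0|exact T]. }
assert (Hsc : ex_series (fun n => d ^ 2 / rho * c n)) by exact (ex_series_scal (d ^ 2 / rho) c Hc).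
assert (AE : abs_conv E) by (apply abs_conv_le with (1 := HEn); exact Hsc).
eapply Rle_trans; [apply CS_bound, AE|].
apply Rle_trans with (2 * (d ^ 2 / rho * K)).
- apply Rmult_le_compat_l; [lra|]. unfold K. rewrite <- Series_scal_l.
  apply Series_le; [|exact Hsc]. intros; split; [apply Cmod_ge_0|apply HEn].
- assert (Hdd : d * (2 * (K + 1)) <= eps * rho).
  { left. apply Rmult_lt_compat_r with (r := 2 * (K + 1)) in Hw2; [|lra].
    unfold Rdiv in Hw2. rewrite (Rmult_assoc (eps * rho)), Rinv_l in Hw2; lra. }
  apply Rmult_le_reg_r with rho; [lra|].
  replace (2 * (d ^ 2 / rho * K) * rho) with (d * (d * (2 * K))) by (field; lra).
  nra.
Qed.

Lemma PS_0 (a : nat -> C) : disk_coeffs a -> PS a 0 = a 0%nat.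
Proof.
intros H. unfold PS. rewrite CS_incr_1.
- rewrite (CS_ext _ (fun n => 0 * (a (S n) * 0 ^ S n))%C) by (intros; simpl; ring).
  rewrite CS_scal; [simpl; ring|].
  apply (proj1 (abs_conv_incr_1 (fun n => a n * 0 ^ n)%C)).
  apply disk_coeffs_abs; [exact H|]. unfold in_disk; rewrite Cmod_0; lra.
- apply disk_coeffs_abs; [exact H|]. unfold in_disk; rewrite Cmod_0; lra.
Qed.

Lemma is_pseries_C (a : nat -> C) (z l : C) :
  @is_pseries C_AbsRing C_NormedModule a z l <->
  @is_series C_AbsRing C_NormedModule (fun n => a n * z ^ n)%C l.
Proof.
unfold is_pseries; split; apply is_series_ext; intros n.
- exact (Cmult_comm (z ^ n) (a n)).
- exact (Cmult_comm (a n) (z ^ n)).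
Qed.

Lemma is_pseries_PS (a : nat -> C) (z : C) :
  disk_coeffs a -> in_disk z -> @is_pseries C_AbsRing C_NormedModule a z (PS a z).
Proof.
intros Ha Hz. apply is_pseries_C, is_series_C.
assert (H := disk_coeffs_abs a z Ha Hz). split; [apply (CS_Re _ H)|apply (CS_Im _ H)].
Qed.

Lemma is_pseries_PS_unique (a : nat -> C) (z l : C) :
  @is_pseries C_AbsRing C_NormedModule a z l -> l = PS a z.
Proof.
rewrite is_pseries_C, is_series_C. intros [H1 H2]. symmetry. now apply CS_unique.
Qed.

Lemma null_sequence_bounded (u : nat -> R) : is_lim_seq u 0 -> exists M, forall n, Rabs (u n) <= M.
Proof.
intros H. apply is_lim_seq_Reals in H.
destruct (maj_by_pos u (exist _ 0 H)) as [M [_ HM]]. now exists M.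
Qed.

Lemma disk_coeffs_of_pseries (a : nat -> C) (f : C -> C) :
  (forall z, in_disk z -> @is_pseries C_AbsRing C_NormedModule a z (f z)) -> disk_coeffs a.
Proof.
intros H r Hr.
assert (Hd : in_disk r) by (unfold in_disk; rewrite Cmod_R, Rabs_pos_eq; lra).
specialize (H r Hd). rewrite is_pseries_C, is_series_C in H. destruct H as [H1 H2].
destruct (null_sequence_bounded _ (ex_series_lim_0 _ (ex_intro _ _ H1))) as [M1 B1].
destruct (null_sequence_bounded _ (ex_series_lim_0 _ (ex_intro _ _ H2))) as [M2 B2].
exists (M1 + M2). intros n.
replace (Cmod (a n) * r ^ n) with (Cmod (a n * r ^ n)).
- eapply Rle_trans; [apply Cmod_le_abs|]. specialize (B1 n); specialize (B2 n). lra.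
- rewrite Cmod_mult, Cmod_pow, Cmod_R, Rabs_pos_eq; lra.
Qed.

(** * Repeatedly differentiable functions on the disk *)

Definition disk_deriv (f f' : C -> C) : Prop := forall z, in_disk z -> Cder f z (f' z).

Lemma in_disk_near (z w : C) : Cmod (w - z) < 1 - Cmod z -> in_disk w.
Proof.
intros H. assert (T := Cmod_triangle (w - z) z).
replace (w - z + z)%C with w in T by ring. unfold in_disk; lra.
Qed.

Lemma Cder_ext_disk (f g : C -> C) (z l : C) :
  (forall w, in_disk w -> f w = g w) -> in_disk z -> Cder f z l -> Cder g z l.
Proof.
intros E Hz. apply (Cder_ext_loc f g z l (1 - Cmod z)); [unfold in_disk in Hz; lra|].
intros w Hw. apply E. now apply in_disk_near with z.
Qed.

(** Used for all [n] at once, as a class closed under the field operations: a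
    function known only to satisfy a differential equation is then seen to be
    smooth by induction on [n]. *)
Fixpoint smooth (n : nat) (f : C -> C) : Prop :=
  match n with
  | O => True
  | S k => exists f', disk_deriv f f' /\ smooth k f'
  end.

Lemma smooth_ext (n : nat) (f g : C -> C) :
  (forall z, in_disk z -> f z = g z) -> smooth n f -> smooth n g.
Proof.
destruct n as [|n]; [easy|]. intros E [f' [H1 H2]]. exists f'; split; [|exact H2].
intros z Hz. apply Cder_ext_disk with f; auto.
Qed.

Lemma smooth_pred (n : nat) (f : C -> C) : smooth (S n) f -> smooth n f.
Proof.
revert f; induction n as [|n IH]; intros f; [easy|].
intros [f' [H1 H2]]. exists f'; split; [exact H1|now apply IH].
Qed.

Lemma smooth_const (n : nat) (c : C) : smooth n (fun _ => c).
Proof.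
revert c; induction n as [|n IH]; intros c; [easy|].
exists (fun _ => RtoC 0); split; [|apply IH]. intros z _; apply Cder_const.
Qed.

Lemma smooth_id (n : nat) : smooth n (fun z => z).
Proof.
destruct n as [|n]; [easy|]. exists (fun _ => RtoC 1); split; [|apply smooth_const].
intros z _; apply Cder_id.
Qed.

Lemma smooth_plus (n : nat) (f g : C -> C) :
  smooth n f -> smooth n g -> smooth n (fun z => f z + g z)%C.
Proof.
revert f g; induction n as [|n IH]; intros f g; [easy|].
intros [f' [F1 F2]] [g' [G1 G2]]. exists (fun z => f' z + g' z)%C; split; [|now apply IH].
intros z Hz; apply Cder_plus; auto.
Qed.

Lemma smooth_mult (n : nat) (f g : C -> C) :
  smooth n f -> smooth n g -> smooth n (fun z => f z * g z)%C.
Proof.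
revert f g; induction n as [|n IH]; intros f g; [easy|].
intros Hf Hg. assert (Hf' := smooth_pred _ _ Hf). assert (Hg' := smooth_pred _ _ Hg).
destruct Hf as [f' [F1 F2]], Hg as [g' [G1 G2]].
exists (fun z => f' z * g z + f z * g' z)%C; split.
- intros z Hz; apply Cder_mult; auto.
- apply smooth_plus; apply IH; auto.
Qed.

Lemma smooth_opp (n : nat) (f : C -> C) : smooth n f -> smooth n (fun z => - f z)%C.
Proof.
intros H. apply smooth_ext with (fun z => - (1) * f z)%C; [intros; ring|].
apply smooth_mult; [apply smooth_const|exact H].
Qed.

Lemma smooth_inv (n : nat) (f : C -> C) :
  (forall z, in_disk z -> f z <> 0%C) -> smooth n f -> smooth n (fun z => / f z)%C.
Proof.
revert f; induction n as [|n IH]; intros f; [easy|].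
intros Hz Hf. assert (Hf' := smooth_pred _ _ Hf). destruct Hf as [f' [F1 F2]].
exists (fun z => - (/ f z * / f z) * f' z)%C; split.
- intros z Dz. replace (/ f z * / f z)%C with (/ (f z * f z))%C by (field; auto).
  apply (Cder_comp Cinv f); [apply Cder_inv|]; auto.
- apply smooth_mult; [|exact F2]. apply smooth_opp, smooth_mult; apply IH; auto.
Qed.

Lemma smooth_PS (n : nat) (a : nat -> C) : disk_coeffs a -> smooth n (PS a).
Proof.
revert a; induction n as [|n IH]; intros a Ha; [easy|].
exists (PS (dseq a)); split; [|apply IH, disk_coeffs_dseq, Ha].
intros z Hz; now apply Cder_PS.
Qed.

(** * Means over circles *)

Definition circ (r t : R) : C := (r * cos t, r * sin t).
(** Only real parts are integrated, and without normalisation: complex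
    constants can be moved inside [F], so this loses nothing and keeps every
    integral real. *)
Definition cmean (r : R) (F : C -> C) : R := RInt (fun t => Re (F (circ r t))) 0 (2 * PI).

Lemma Cmod_circ (r t : R) : 0 <= r -> Cmod (circ r t) = r.
Proof.
intros Hr. apply Rsqr_inj; [apply Cmod_ge_0|lra|].
rewrite !Rsqr_pow2, Cmod2_alt. unfold circ, Re, Im; simpl.
generalize (sin2_cos2 t); unfold Rsqr; intros; nra.
Qed.

Lemma circ_disk (r t : R) : 0 <= r < 1 -> in_disk (circ r t).
Proof. intros; unfold in_disk; rewrite Cmod_circ; lra. Qed.

Lemma circ_nz (r t : R) : 0 < r -> circ r t <> 0%C.
Proof. intros H E. assert (T := Cmod_circ r t ltac:(lra)). rewrite E, Cmod_0 in T; lra. Qed.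

Lemma Rder_circ (r t : R) : Rder (circ r) t (Ci * circ r t)%C.
Proof.
unfold Rder, circ, Re, Im; simpl. split; auto_derive; auto; ring.
Qed.

Lemma Rder_radius (r t : R) : Rder (fun u => circ u t) r (circ 1 t).
Proof. unfold Rder, circ, Re, Im; simpl. split; auto_derive; auto; ring. Qed.

Definition circ_cont (r : R) (F : C -> C) : Prop :=
  forall t, continuous (fun t => Re (F (circ r t))) t.

Lemma Rder_continuous (c : R -> C) (t : R) (v : C) :
  Rder c t v -> continuous (fun u => Re (c u)) t.
Proof. intros [H _]. apply @ex_derive_continuous. now exists (Re v). Qed.

Lemma circ_cont_deriv (r : R) (F F' : C -> C) :
  (forall t, Cder F (circ r t) (F' (circ r t))) -> circ_cont r F.
Proof.
intros H t. apply (Rder_continuous (fun u => F (circ r u)) t (F' (circ r t) * (Ci * circ r t))%C).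
apply (Rder_comp F (circ r)); [apply H|apply Rder_circ].
Qed.

Lemma circ_cont_disk (r : R) (F F' : C -> C) :
  0 <= r < 1 -> disk_deriv F F' -> circ_cont r F.
Proof. intros Hr H. apply circ_cont_deriv with F'. intros; now apply H, circ_disk. Qed.

Lemma circ_cont_ex_RInt (r : R) (F : C -> C) a b :
  circ_cont r F -> ex_RInt (fun t => Re (F (circ r t))) a b.
Proof. intros H. apply (@ex_RInt_continuous R_CompleteNormedModule). intros; apply H. Qed.

Lemma cmean_ext (r : R) (F G : C -> C) :
  (forall t, F (circ r t) = G (circ r t)) -> cmean r F = cmean r G.
Proof. intros H. apply RInt_ext. intros; now rewrite H. Qed.

Lemma cmean_plus (r : R) (F G : C -> C) :
  circ_cont r F -> circ_cont r G -> cmean r (fun z => F z + G z)%C = cmean r F + cmean r G.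
Proof.
intros HF HG. apply (RInt_plus (fun t => Re (F (circ r t))) (fun t => Re (G (circ r t))));
apply circ_cont_ex_RInt; assumption.
Qed.

(** Up to the factor [Ci], [z G'(z)] is the derivative of [G] in the angle, and
    the integral of that derivative over a full turn vanishes. This gives both
    the mean value property and the extraction of Taylor coefficients. *)
Lemma cmean_angular (r : R) (G G' : C -> C) :
  (forall t, Cder G (circ r t) (G' (circ r t))) -> circ_cont r (fun z => z * G' z)%C ->
  cmean r (fun z => z * G' z)%C = 0.
Proof.
intros HG Hc.
assert (H : is_RInt (fun t => Re (circ r t * G' (circ r t))%C) 0 (2 * PI)
   (minus (Im (G (circ r (2 * PI)))) (Im (G (circ r 0))))).
{ apply (@is_RInt_derive R_CompleteNormedModule (fun t => Im (G (circ r t)))).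
  - intros t _. destruct (Rder_comp G (circ r) t _ _ (HG t) (Rder_circ r t)) as [_ H].
    replace (Re (circ r t * G' (circ r t))%C) with (Im (G' (circ r t) * (Ci * circ r t))%C); [exact H|].
    unfold Re, Im; simpl; ring.
  - intros t _. apply Hc. }
apply (@is_RInt_unique R_CompleteNormedModule) in H. unfold cmean. rewrite H.
unfold circ. rewrite cos_2PI, sin_2PI, cos_0, sin_0. apply Rminus_diag.
Qed.

Lemma continuity_2d_circ (F F' : C -> C) (r t : R) :
  Cder F (circ r t) (F' (circ r t)) ->
  continuity_2d_pt (fun u v => Re (F (circ u v) * circ 1 v)%C) r t.
Proof.
intros H.
assert (Hc := Cder_cont _ _ _ H).
assert (K1 : continuity_2d_pt (fun u v => u * cos v) r t).
{ apply continuity_2d_pt_mult; [apply continuity_2d_pt_id1|].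
  apply continuity_1d_2d_pt_comp; [apply continuity_cos|apply continuity_2d_pt_id2]. }
assert (K2 : continuity_2d_pt (fun u v => u * sin v) r t).
{ apply continuity_2d_pt_mult; [apply continuity_2d_pt_id1|].
  apply continuity_1d_2d_pt_comp; [apply continuity_sin|apply continuity_2d_pt_id2]. }
assert (K : forall eps, 0 < eps -> locally_2d (fun u v => Cmod (F (circ u v) - F (circ r t)) < eps) r t).
{ intros eps He. destruct (Hc eps He) as [d [Hd W]].
  assert (L := locally_2d_and _ _ _ _ (K1 (mkposreal (d / 2) ltac:(lra))) (K2 (mkposreal (d / 2) ltac:(lra)))).
  revert L. apply locally_2d_impl, locally_2d_forall. intros u v [L1 L2]. simpl in L1, L2.
  apply W. eapply Rle_lt_trans; [apply Cmod_le_abs|]. unfold Re, Im, circ; simpl.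
  unfold Rminus in *; lra. }
assert (R1 : continuity_2d_pt (fun u v => Re (F (circ u v))) r t).
{ intros eps. generalize (K eps (cond_pos eps)). apply locally_2d_impl, locally_2d_forall.
  intros u v L. eapply Rle_lt_trans; [|exact L]. apply (re_le_Cmod (F (circ u v) - F (circ r t))). }
assert (I1 : continuity_2d_pt (fun u v => Im (F (circ u v))) r t).
{ intros eps. generalize (K eps (cond_pos eps)). apply locally_2d_impl, locally_2d_forall.
  intros u v L. eapply Rle_lt_trans; [|exact L]. apply (im_le_Cmod (F (circ u v) - F (circ r t))). }
apply continuity_2d_pt_ext with (fun u v => Re (F (circ u v)) * cos v - Im (F (circ u v)) * sin v).
{ intros u v. unfold Re, Im; simpl; ring. }
apply continuity_2d_pt_minus; apply continuity_2d_pt_mult; try assumption.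
- apply continuity_1d_2d_pt_comp; [apply continuity_cos|apply continuity_2d_pt_id2].
- apply continuity_1d_2d_pt_comp; [apply continuity_sin|apply continuity_2d_pt_id2].
Qed.

Lemma disk_deriv_mult_id (F F' : C -> C) :
  disk_deriv F F' -> disk_deriv (fun z => z * F z)%C (fun z => 1 * F z + z * F' z)%C.
Proof. intros H z Hz. apply (Cder_mult (fun z => z)); [apply Cder_id|now apply H]. Qed.

Lemma is_derive_cmean (F F1 F2 : C -> C) (r : R) :
  disk_deriv F F1 -> disk_deriv F1 F2 -> -1 < r < 1 ->
  is_derive (fun x => cmean x F) r (RInt (fun t => Re (F1 (circ r t) * circ 1 t)%C) 0 (2 * PI)).
Proof.
intros H1 H2 Hr.
assert (Hdisk : forall u t, -1 < u < 1 -> in_disk (circ u t)).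
{ intros u t Hu. destruct (Rle_lt_dec 0 u); [apply circ_disk; lra|].
  unfold in_disk. replace (circ u t) with (- circ (- u) t)%C
    by (unfold circ, Copp; simpl; f_equal; ring).
  rewrite Cmod_opp, Cmod_circ; lra. }
assert (D : forall u t, -1 < u < 1 ->
   is_derive (fun x => Re (F (circ x t))) u (Re (F1 (circ u t) * circ 1 t)%C)).
{ intros u t Hu. apply (Rder_comp F (fun x => circ x t) u _ _ (H1 _ (Hdisk u t Hu)) (Rder_radius u t)). }
assert (Hloc : locally r (fun u => -1 < u < 1)).
{ exists (mkposreal (Rmin (1 - r) (r + 1)) ltac:(apply Rmin_pos; lra)). intros u Hu.
  unfold ball in Hu; simpl in Hu; unfold AbsRing_ball, abs, minus, plus, opp in Hu; simpl in Hu.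
  generalize (Rmin_l (1 - r) (r + 1)) (Rmin_r (1 - r) (r + 1)). apply Rabs_def2 in Hu. lra. }
rewrite <- (RInt_ext (fun t => Derive (fun u => Re (F (circ u t))) r)).
2:{ intros t _. apply is_derive_unique, D, Hr. }
apply (is_derive_RInt_param (fun x t => Re (F (circ x t)))).
- revert Hloc. apply filter_imp. intros u Hu t _. eexists; apply D, Hu.
- intros t _. apply continuity_2d_pt_ext_loc with (fun u v => Re (F1 (circ u v) * circ 1 v)%C).
  + destruct Hloc as [d Hd]. exists d. intros u v Hu _. symmetry. apply is_derive_unique, D, Hd, Hu.
  + apply continuity_2d_circ with F2. apply H2, Hdisk, Hr.
- revert Hloc. apply filter_imp. intros u Hu.
  apply circ_cont_ex_RInt, circ_cont_deriv with F1. intros; apply H1, Hdisk, Hu.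
Qed.

(** The derivative of the mean in the radius [u] is [1 / u] times the integral
    of an angular derivative, hence zero for [u > 0]; at [u = 0] the mean is still
    differentiable, hence continuous. *)
Lemma mean_value (F F1 F2 : C -> C) (r : R) :
  disk_deriv F F1 -> disk_deriv F1 F2 -> 0 <= r < 1 -> cmean r F = 2 * PI * Re (F 0).
Proof.
intros H1 H2 Hr.
assert (H0 : cmean 0 F = 2 * PI * Re (F 0)).
{ unfold cmean. rewrite (RInt_ext _ (fun _ => Re (F 0))).
  - rewrite RInt_const. unfold scal; simpl; unfold mult; simpl. ring.
  - intros t _. do 2 f_equal. unfold circ, RtoC. f_equal; ring. }
rewrite <- H0.
destruct (MVT_gen (fun x => cmean x F) 0 r (fun _ => 0)) as [c [_ Hc]].
- intros u Hu. rewrite Rmin_left, Rmax_right in Hu by lra.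
  replace 0 with (RInt (fun t => Re (F1 (circ u t) * circ 1 t)%C) 0 (2 * PI)).
  { apply is_derive_cmean with F2; auto; lra. }
  apply Rmult_eq_reg_l with u; [|lra]. rewrite Rmult_0_r.
  transitivity (cmean u (fun z => z * F1 z)%C); [|apply cmean_angular with F].
  + symmetry. unfold cmean. rewrite <- (RInt_scal (V := R_CompleteNormedModule) _ _ _ u).
    * apply RInt_ext. intros t _. unfold scal; simpl; unfold mult; simpl.
      unfold circ, Re, Im; simpl. ring.
    * apply (@ex_RInt_continuous R_CompleteNormedModule). intros t _.
      apply continuous_ext with (fun t => / u * Re (circ u t * F1 (circ u t))%C).
      { intros x. unfold circ, Re; simpl. field. lra. }
      apply (continuous_scal_r (/ u) (fun t => Re (circ u t * F1 (circ u t))%C)).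
      apply (circ_cont_disk u _ _ ltac:(lra) (disk_deriv_mult_id _ _ H2)).
  + intros t; apply H1, circ_disk; lra.
  + apply (circ_cont_disk u _ _ ltac:(lra) (disk_deriv_mult_id _ _ H2)).
- intros u Hu. rewrite Rmin_left, Rmax_right in Hu by lra.
  apply continuity_pt_filterlim. apply (@ex_derive_continuous R_AbsRing R_NormedModule).
  eexists; apply is_derive_cmean with F2; eauto; lra.
- lra.
Qed.

(** * The Schwarz-Pick inequality for the second coefficient *)

Lemma in_disk_0 : in_disk 0.
Proof. unfold in_disk; rewrite Cmod_0; lra. Qed.

Lemma disk_deriv_scal (c : C) (F F' : C -> C) :
  disk_deriv F F' -> disk_deriv (fun z => c * F z)%C (fun z => c * F' z)%C.
Proof.
intros H z Hz. replace (c * F' z)%C with (0 * F z + c * F' z)%C by ring.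
apply (Cder_mult (fun _ => c)); [apply Cder_const|now apply H].
Qed.

Lemma circ_cont_plus (r : R) (F G : C -> C) :
  circ_cont r F -> circ_cont r G -> circ_cont r (fun z => F z + G z)%C.
Proof.
intros HF HG t.
exact (continuous_plus (fun t => Re (F (circ r t))) (fun t => Re (G (circ r t))) t (HF t) (HG t)).
Qed.

Lemma Cder_div_id (F F' : C -> C) (z : C) :
  z <> 0%C -> Cder F z (F' z) -> Cder (fun w => F w / w)%C z ((F' z - F z / z) / z)%C.
Proof.
intros Hz H. replace ((F' z - F z / z) / z)%C with (F' z * / z + F z * - / (z * z))%C by (field; auto).
apply (Cder_mult F Cinv); [exact H|now apply Cder_inv].
Qed.

Lemma circ_cont_div (r : R) (F F' : C -> C) :
  0 < r < 1 -> disk_deriv F F' -> circ_cont r (fun z => F z / z)%C.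
Proof.
intros Hr H. apply circ_cont_deriv with (fun z => (F' z - F z / z) / z)%C.
intros t. apply Cder_div_id; [apply circ_nz; lra|apply H, circ_disk; lra].
Qed.

Lemma circ_cont_div2 (r : R) (F F' : C -> C) :
  0 < r < 1 -> disk_deriv F F' -> circ_cont r (fun z => F z / z / z)%C.
Proof.
intros Hr H. set (G := fun z => ((F' z - F z / z) / z)%C).
apply circ_cont_deriv with (fun z => (G z - F z / z / z) / z)%C.
intros t. apply (Cder_div_id (fun z => F z / z)%C G); [apply circ_nz; lra|].
apply Cder_div_id; [apply circ_nz; lra|apply H, circ_disk; lra].
Qed.

Lemma circ_cont_opp (r : R) (F : C -> C) : circ_cont r F -> circ_cont r (fun z => - F z)%C.
Proof. intros H t. exact (continuous_opp (fun t => Re (F (circ r t))) t (H t)). Qed.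

Lemma cmean_opp (r : R) (F : C -> C) : circ_cont r F -> cmean r (fun z => - F z)%C = - cmean r F.
Proof.
intros H. apply (RInt_opp (V := R_CompleteNormedModule) (fun t => Re (F (circ r t)))).
now apply circ_cont_ex_RInt.
Qed.

(** Apply [cmean_angular] to [F z / z]: a Fourier coefficient of [F] is traded
    for a lower one of its derivative. *)
Lemma cmean_div (r : R) (F F1 F2 : C -> C) :
  0 < r < 1 -> disk_deriv F F1 -> disk_deriv F1 F2 ->
  cmean r (fun z => F z / z)%C = cmean r F1.
Proof.
intros Hr H H1.
assert (E : forall t, (circ r t * ((F1 (circ r t) - F (circ r t) / circ r t) / circ r t)
   = F1 (circ r t) + - (F (circ r t) / circ r t))%C).
{ intros t. field. apply circ_nz; lra. }
assert (A : circ_cont r F1) by (apply circ_cont_disk with F2; [lra|assumption]).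
assert (B : circ_cont r (fun z => F z / z)%C) by (apply circ_cont_div with F1; assumption).
assert (K := cmean_angular r (fun z => F z / z)%C (fun z => (F1 z - F z / z) / z)%C).
rewrite (cmean_ext _ _ (fun z => F1 z + - (F z / z))%C E), cmean_plus, cmean_opp in K;
  try assumption; [|now apply circ_cont_opp].
enough (cmean r F1 + - cmean r (fun z => F z / z)%C = 0) by lra.
apply K.
- intros t. apply Cder_div_id; [apply circ_nz; lra|apply H, circ_disk; lra].
- intros t. apply continuous_ext with (fun t => Re (F1 (circ r t) + - (F (circ r t) / circ r t))%C).
  { intros x; now rewrite E. }
  exact (circ_cont_plus r _ _ A (circ_cont_opp r _ B) t).
Qed.

Lemma cmean_div2 (r : R) (F F1 F2 : C -> C) :
  0 < r < 1 -> disk_deriv F F1 -> disk_deriv F1 F2 ->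
  2 * cmean r (fun z => F z / z / z)%C = cmean r (fun z => F1 z / z)%C.
Proof.
intros Hr H H1.
set (G := fun z => ((F1 z - F z / z) / z)%C).
assert (E : forall t, (circ r t * ((G (circ r t) - F (circ r t) / circ r t / circ r t) / circ r t)
   = F1 (circ r t) / circ r t + - (F (circ r t) / circ r t / circ r t
        + F (circ r t) / circ r t / circ r t))%C).
{ intros t. unfold G. field. apply circ_nz; lra. }
assert (A : circ_cont r (fun z => F1 z / z)%C) by (apply circ_cont_div with F2; assumption).
assert (B : circ_cont r (fun z => F z / z / z)%C) by (apply circ_cont_div2 with F1; assumption).
assert (BB := circ_cont_plus r _ _ B B).
assert (K := cmean_angular r (fun z => F z / z / z)%C (fun z => (G z - F z / z / z) / z)%C).
rewrite (cmean_ext _ _ (fun z => F1 z / z + - (F z / z / z + F z / z / z))%C E), cmean_plus, cmean_opp, cmean_plus in K;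
  try assumption; [|now apply circ_cont_opp].
enough (cmean r (fun z => F1 z / z)%C + - (cmean r (fun z => F z / z / z)%C + cmean r (fun z => F z / z / z)%C) = 0) by lra.
apply K.
- intros t. apply (Cder_div_id (fun z => F z / z)%C G); [apply circ_nz; lra|].
  apply Cder_div_id; [apply circ_nz; lra|apply H, circ_disk; lra].
- intros t. eapply continuous_ext; [intros x; rewrite E; reflexivity|].
  exact (circ_cont_plus r _ _ A (circ_cont_opp r _ BB) t).
Qed.

Lemma even_quartic_limit_at_1 (a b c : R) :
  (forall r, 0 < r < 1 -> a + b * r ^ 2 + c * r ^ 4 >= 0) -> a + b + c >= 0.
Proof.
intros H. apply Rle_ge, Rnot_lt_le. intros Hn.
assert (D : continuity_pt (fun r => a + b * r ^ 2 + c * r ^ 4) 1) by reg.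
destruct (D (- (a + b + c)) ltac:(lra)) as [d [Hd W]].
set (x := Rmax (1 / 2) (1 - d / 2)).
assert (X1 : 1 / 2 <= x) by apply Rmax_l. assert (X2 : 1 - d / 2 <= x) by apply Rmax_r.
assert (X3 : x < 1) by (apply Rmax_lub_lt; lra).
specialize (W x). specialize (H x ltac:(lra)).
assert (W' : R_dist (a + b * x ^ 2 + c * x ^ 4) (a + b * 1 ^ 2 + c * 1 ^ 4) < - (a + b + c)).
{ apply W. split; [split; [exact I|lra]|]. simpl. unfold R_dist. apply Rabs_def1; lra. }
unfold R_dist in W'. apply Rabs_def2 in W'. simpl in *. lra.
Qed.

Lemma Re_Cconj_mult (z : C) : Re (z * Cconj z) = Cmod z ^ 2.
Proof. rewrite Cmod2_alt. unfold Re, Im; simpl; ring. Qed.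

Section Schwarz.
Variables w w1 w2 w3 w4 : C -> C.
Hypothesis H1 : disk_deriv w w1.
Hypothesis H2 : disk_deriv w1 w2.
Hypothesis H3 : disk_deriv w2 w3.
Hypothesis H4 : disk_deriv w3 w4.
Hypothesis Hb : forall z, in_disk z -> in_disk (w z).
Hypothesis H0 : w 0 = 0%C.

(** For [|w| <= 1] one has [2 Re (w u conj v) <= |u|^2 + |v|^2]. Integrate this
    over the circle of radius [r] with [u = x + y z] and [v = A z + B z^2]. On
    the circle [conj z = r^2 / z], so the left side only sees the Taylor
    coefficients of [w] of order at most 2. *)
Lemma schwarz_form_r (x y A B : C) (r : R) : 0 < r < 1 ->
  2 * Re ((x * Cconj A * r ^ 2 + y * Cconj B * r ^ 4) * w1 0 + x * Cconj B * r ^ 4 * (w2 0 / 2))%C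
  <= Cmod x ^ 2 + Cmod y ^ 2 * r ^ 2 + Cmod A ^ 2 * r ^ 2 + Cmod B ^ 2 * r ^ 4.
Proof.
intros Hr.
set (a := (x * Cconj A * r ^ 2 + y * Cconj B * r ^ 4)%C).
set (b := (x * Cconj B * r ^ 4)%C).
set (c := (y * Cconj A * r ^ 2)%C).
set (F := fun z => (a * w z / z + (b * w z / z / z + c * w z))%C).
assert (Ca : circ_cont r (fun z => a * w z / z)%C).
{ apply circ_cont_div with (fun z => a * w1 z)%C; [exact Hr|now apply disk_deriv_scal]. }
assert (Cb : circ_cont r (fun z => b * w z / z / z)%C).
{ apply circ_cont_div2 with (fun z => b * w1 z)%C; [exact Hr|now apply disk_deriv_scal]. }
assert (Cc : circ_cont r (fun z => c * w z)%C).
{ apply circ_cont_disk with (fun z => c * w1 z)%C; [lra|now apply disk_deriv_scal]. }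
assert (CF : circ_cont r F) by (apply circ_cont_plus; [|apply circ_cont_plus]; assumption).
assert (MF : cmean r F = 2 * PI * Re (a * w1 0 + b * (w2 0 / 2))%C).
{ unfold F. rewrite cmean_plus; [|exact Ca|apply circ_cont_plus; assumption].
  rewrite cmean_plus by assumption.
  rewrite (cmean_div r (fun z => a * w z)%C (fun z => a * w1 z)%C (fun z => a * w2 z)%C) by (try apply disk_deriv_scal; auto).
  rewrite (mean_value (fun z => a * w1 z)%C (fun z => a * w2 z)%C (fun z => a * w3 z)%C) by (try apply disk_deriv_scal; auto; lra).
  rewrite (mean_value (fun z => c * w z)%C (fun z => c * w1 z)%C (fun z => c * w2 z)%C) by (try apply disk_deriv_scal; auto; lra).
  assert (E := cmean_div2 r (fun z => b * w z)%C (fun z => b * w1 z)%C (fun z => b * w2 z)%C Hr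
     (disk_deriv_scal b _ _ H1) (disk_deriv_scal b _ _ H2)).
  cbv beta in E.
  rewrite (cmean_div r (fun z => b * w1 z)%C (fun z => b * w2 z)%C (fun z => b * w3 z)%C) in E by (try apply disk_deriv_scal; auto).
  rewrite (mean_value (fun z => b * w2 z)%C (fun z => b * w3 z)%C (fun z => b * w4 z)%C) in E by (try apply disk_deriv_scal; auto; lra).
  replace (cmean r (fun z => b * w z / z / z)%C) with (PI * Re (b * w2 0)%C) by lra.
  rewrite H0. replace (b * (w2 0 / 2))%C with (RtoC (/ 2) * (b * w2 0))%C
    by (rewrite RtoC_inv by lra; unfold Cdiv; ring).
  unfold Re; simpl; field. }
set (k := Cmod x ^ 2 + Cmod y ^ 2 * r ^ 2 + Cmod A ^ 2 * r ^ 2 + Cmod B ^ 2 * r ^ 4).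
(* [Re (G z)] is [|u|^2 + |v|^2] on the circle; its linear part has mean 0. *)
set (l := (2 * (Cconj x * y + r ^ 2 * (Cconj A * B)))%C).
set (G := fun z => (RtoC k + l * z)%C).
assert (DG : disk_deriv G (fun _ => l)).
{ intros z Hz. clearbody l.
  assert (K := Cder_plus _ _ z _ _ (Cder_const k z)
    (Cder_mult (fun _ => l) (fun w => w) z _ _ (Cder_const l z) (Cder_id z))).
  cbv beta in K. replace (0 + (0 * z + l * 1))%C with l in K by ring. exact K. }
assert (DG' : disk_deriv (fun _ => l) (fun _ => RtoC 0)) by (intros z Hz; apply Cder_const).
assert (MG : cmean r G = 2 * PI * k).
{ rewrite (mean_value G _ _ r DG DG') by lra. unfold G, Re; simpl; ring. }
assert (CG : circ_cont r G) by (apply circ_cont_disk with (fun _ => l); [lra|exact DG]).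
assert (L : cmean r (fun z => F z + F z)%C <= cmean r G).
{ apply RInt_le; [generalize PI_RGT_0; lra| | |].
  - apply (circ_cont_ex_RInt r (fun z => F z + F z)%C), circ_cont_plus; assumption.
  - now apply circ_cont_ex_RInt.
  - intros t _. set (z := circ r t).
    assert (Hz : z <> 0%C) by (apply circ_nz; lra).
    assert (Mz : Cmod z = r) by (apply Cmod_circ; lra).
    assert (Hzz : (z * Cconj z = r ^ 2)%C).
    { rewrite <- Cmod2_conj, Mz, RtoC_pow. reflexivity. }
    set (u := (x + y * z)%C). set (v := (A * z + B * (z * z))%C).
    assert (EF : F z = (w z * (u * Cconj v))%C).
    { unfold F, u, v, a, b, c. rewrite Cplus_conj, !Cmult_conj.
      replace (Cconj z) with (r ^ 2 / z)%C by (rewrite <- Hzz; field; exact Hz).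
      field; exact Hz. }
    assert (EG : Re (G z) = Cmod u ^ 2 + Cmod v ^ 2).
    { assert (R2 : r ^ 2 = Re z ^ 2 + Im z ^ 2) by (rewrite <- Cmod2_alt, Mz; reflexivity).
      unfold G, k, l. replace (r ^ 4) with (r ^ 2 * r ^ 2) by ring.
      rewrite <- RtoC_pow, R2, !Cmod2_alt. unfold u, v. clearbody z.
      destruct x, y, A, B, z; unfold Re, Im; simpl; ring. }
    change (Re (F z + F z)%C <= Re (G z)). rewrite EG.
    assert (M : Re (F z) <= Cmod u * Cmod v).
    { eapply Rle_trans; [apply Rle_abs|]. eapply Rle_trans; [apply re_le_Cmod|].
      rewrite EF, !Cmod_mult, Cmod_conj.
      assert (Wz : Cmod (w z) < 1) by (apply Hb, circ_disk; lra).
      assert (U := Cmod_ge_0 u); assert (V := Cmod_ge_0 v).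
      assert (0 <= Cmod u * Cmod v) by (apply Rmult_le_pos; lra). nra. }
    replace (Re (F z + F z)%C) with (2 * Re (F z)) by (unfold Re; simpl; ring).
    assert (S := Rle_0_sqr (Cmod u - Cmod v)). unfold Rsqr in S. nra. }
rewrite cmean_plus, MF, MG in L by assumption.
assert (P := PI_RGT_0).
apply Rmult_le_reg_l with (2 * PI); [lra|].
fold k in L |- *. lra.
Qed.

(** Let [r] tend to 1 and take for [A] and [B] the first two coefficients of
    [w u]. The inequality says that multiplication by [w], cut down to two
    coefficients, is a contraction. *)
Lemma schwarz_form (x y : C) :
  Cmod (w1 0 * x) ^ 2 + Cmod (w1 0 * y + w2 0 / 2 * x) ^ 2 <= Cmod x ^ 2 + Cmod y ^ 2.
Proof.
set (A := (w1 0 * x)%C). set (B := (w1 0 * y + w2 0 / 2 * x)%C).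
assert (L := even_quartic_limit_at_1 (Cmod x ^ 2)
  (Cmod y ^ 2 + Cmod A ^ 2 - 2 * Re (x * Cconj A * w1 0)%C)
  (Cmod B ^ 2 - 2 * Re (y * Cconj B * w1 0 + x * Cconj B * (w2 0 / 2))%C)).
assert (E : Re (x * Cconj A * w1 0)%C = Cmod A ^ 2).
{ rewrite <- Re_Cconj_mult. unfold A. f_equal; ring. }
assert (E' : Re (y * Cconj B * w1 0 + x * Cconj B * (w2 0 / 2))%C = Cmod B ^ 2).
{ rewrite <- Re_Cconj_mult. replace (B * Cconj B)%C with ((w1 0 * y + w2 0 / 2 * x) * Cconj B)%C by reflexivity.
  f_equal; ring. }
enough (K : Cmod x ^ 2 + (Cmod y ^ 2 + Cmod A ^ 2 - 2 * Re (x * Cconj A * w1 0)%C)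
   + (Cmod B ^ 2 - 2 * Re (y * Cconj B * w1 0 + x * Cconj B * (w2 0 / 2))%C) >= 0).
{ rewrite E, E' in K. lra. }
apply L. intros r Hr. apply Rle_ge.
assert (K := schwarz_form_r x y A B r Hr).
replace ((x * Cconj A * r ^ 2 + y * Cconj B * r ^ 4) * w1 0 + x * Cconj B * r ^ 4 * (w2 0 / 2))%C
  with (RtoC (r ^ 2) * (x * Cconj A * w1 0) + RtoC (r ^ 4) * (y * Cconj B * w1 0 + x * Cconj B * (w2 0 / 2)))%C
  in K by (rewrite !RtoC_pow; ring).
set (P := (x * Cconj A * w1 0)%C) in *. set (Q := (y * Cconj B * w1 0 + x * Cconj B * (w2 0 / 2))%C) in *.
replace (Re (RtoC (r ^ 2) * P + RtoC (r ^ 4) * Q)%C) with (r ^ 2 * Re P + r ^ 4 * Re Q) in K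
  by (unfold Re; simpl; ring).
lra.
Qed.

(** The contraction is tested on [(1, conj a * b / (1 - |a|^2))], the vector on
    which it is sharpest; when [|a| = 1] the vector [(1, 0)] gives [b = 0]. *)
Lemma schwarz_coeffs : Cmod (w2 0 / 2)%C <= 1 - Cmod (w1 0) ^ 2.
Proof.
set (a := w1 0) in *. set (b := (w2 0 / 2)%C) in *.
assert (F := schwarz_form). fold a b in F.
assert (Ha0 := Cmod_ge_0 a). assert (Hb0 := Cmod_ge_0 b).
assert (Ha : Cmod a <= 1).
{ assert (K := F 0%C 1%C). replace (a * 1 + b * 0)%C with a in K by ring.
  rewrite Cmult_0_r, Cmod_0, Cmod_1 in K. nra. }
destruct (Rle_lt_or_eq_dec _ _ Ha) as [Hlt|He].
- set (d := 1 - Cmod a ^ 2). assert (Hd : 0 < d) by (unfold d; nra).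
  assert (K := F 1%C (Cconj a * b * / RtoC d)%C).
  assert (Hdc : RtoC d <> 0%C) by (apply RtoC_neq_0; lra).
  replace (a * (Cconj a * b * / RtoC d) + b * 1)%C with (b * / RtoC d)%C in K.
  2:{ replace (a * (Cconj a * b * / RtoC d))%C with (a * Cconj a * (b * / RtoC d))%C by ring.
      rewrite <- Cmod2_conj. replace (Cmod a ^ 2) with (1 - d) by (unfold d; ring).
      rewrite RtoC_minus. field; auto. }
  rewrite Cmult_1_r, !Cmod_mult, Cmod_inv, Cmod_conj, Cmod_1, Cmod_R, Rabs_pos_eq in K by (auto; lra).
  replace (Cmod a ^ 2) with (1 - d) in K by (unfold d; ring).
  replace ((Cmod a * Cmod b * / d) ^ 2) with ((1 - d) * (Cmod b * / d) ^ 2) in K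
    by (unfold d; ring).
  assert (K2 : (Cmod b * / d) ^ 2 <= 1) by nra.
  assert (K3 : Cmod b * / d <= 1).
  { assert (0 <= Cmod b * / d) by (apply Rmult_le_pos; [lra|left; apply Rinv_0_lt_compat; lra]). nra. }
  apply Rmult_le_compat_r with (r := d) in K3; [|lra].
  rewrite Rmult_assoc, Rinv_l in K3 by lra. lra.
- assert (K := F 1%C 0%C). replace (a * 0 + b * 1)%C with b in K by ring.
  rewrite Cmult_1_r, Cmod_0, Cmod_1, He in K. rewrite He. nra.
Qed.
End Schwarz.

(** * Absence of zeros for z g' = Q g *)

Lemma Rder_scale (z : C) (t : R) : Rder (fun u => RtoC u * z)%C t z.
Proof.
split.
- apply is_derive_ext with (fun u => u * Re z).
  { intros; unfold Re; simpl; ring. }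
  auto_derive; auto; ring.
- apply is_derive_ext with (fun u => u * Im z).
  { intros; unfold Im; simpl; ring. }
  auto_derive; auto; ring.
Qed.

Lemma scale_disk (t : R) (z : C) : 0 <= t <= 1 -> in_disk z -> in_disk (t * z).
Proof.
unfold in_disk; intros Ht Hz. rewrite Cmod_mult, Cmod_R, Rabs_pos_eq by lra.
generalize (Cmod_ge_0 z). nra.
Qed.

Lemma Cmod_scale_cont (F : C -> C) (z : C) (t : R) :
  in_disk z -> Ccont F (t * z) -> continuity_pt (fun u => Cmod (F (u * z)%C)) t.
Proof.
intros Hz H eps He. destruct (H eps He) as [d [Hd W]]. exists d; split; [exact Hd|].
intros u [_ Hu]. simpl in *. unfold R_dist in *.
assert (K : Cmod (F (u * z) - F (t * z))%C < eps).
{ apply W. replace (u * z - t * z)%C with (RtoC (u - t) * z)%C by (rewrite RtoC_minus; ring).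
  rewrite Cmod_mult, Cmod_R. unfold in_disk in Hz.
  generalize (Cmod_ge_0 z) (Rabs_pos (u - t)). nra. }
eapply Rle_lt_trans; [|exact K].
assert (T1 := Cmod_triangle (F (u * z) - F (t * z))%C (F (t * z)%C)).
assert (T2 := Cmod_triangle (- (F (u * z) - F (t * z)))%C (F (u * z)%C)).
replace (F (u * z) - F (t * z) + F (t * z))%C with (F (u * z)%C) in T1 by ring.
replace (- (F (u * z) - F (t * z)) + F (u * z))%C with (F (t * z)%C) in T2 by ring.
rewrite Cmod_opp in T2. apply Rabs_le; lra.
Qed.

Lemma first_zero (phi : R -> R) :
  (forall t, 0 <= t <= 1 -> continuity_pt phi t) -> phi 0 <> 0 -> phi 1 = 0 ->
  exists tau, 0 < tau <= 1 /\ phi tau = 0 /\ forall u, 0 <= u < tau -> phi u <> 0.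
Proof.
intros Hc H0 H1.
(* The zero is the supremum of the initial intervals without zeros. *)
set (E := fun t => 0 <= t <= 1 /\ forall u, 0 <= u <= t -> phi u <> 0).
assert (E0 : E 0).
{ split; [lra|]. intros u Hu. now replace u with 0 by lra. }
destruct (completeness E) as [tau [Hub Hlub]].
{ exists 1. intros t [Ht _]; lra. }
{ now exists 0. }
assert (T0 : 0 <= tau) by now apply Hub.
assert (T1 : tau <= 1) by (apply Hlub; intros t [Ht _]; lra).
assert (Hbelow : forall u, 0 <= u < tau -> phi u <> 0).
{ intros u Hu Hz. assert (tau <= u); [|lra]. apply Hlub. intros t [Ht1 Ht2].
  apply Rnot_lt_le; intros Hlt. apply (Ht2 u); [lra|exact Hz]. }
assert (Hz : phi tau = 0).
{ destruct (Req_dec (phi tau) 0) as [|Hnz]; [assumption|exfalso].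
  destruct (Hc tau (conj T0 T1) (Rabs (phi tau)) (Rabs_pos_lt _ Hnz)) as [d [Hd W]].
  assert (Hnear : forall u, Rabs (u - tau) < d -> phi u <> 0).
  { intros u Hu Hzu. destruct (Req_dec u tau) as [->|Hne]; [easy|].
    assert (K : R_dist (phi u) (phi tau) < Rabs (phi tau)).
    { apply W. split; [split; [exact I|auto]|exact Hu]. }
    unfold R_dist in K. rewrite Hzu in K. replace (0 - phi tau) with (- phi tau) in K by ring.
    rewrite Rabs_Ropp in K. lra. }
  set (t := Rmin 1 (tau + d / 2)).
  assert (Ht1 : t <= 1) by apply Rmin_l. assert (Ht2 : t <= tau + d / 2) by apply Rmin_r.
  assert (Ht3 : tau <= t) by (apply Rmin_glb; lra).
  assert (Et : E t).
  { split; [lra|]. intros u Hu. destruct (Rlt_le_dec u tau); [apply Hbelow; lra|].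
    apply Hnear. rewrite Rabs_pos_eq; lra. }
  assert (t = tau) by (specialize (Hub t Et); lra).
  destruct (Rle_lt_or_eq_dec _ _ T1) as [Hlt|He].
  - assert (tau < t) by (apply Rmin_glb_lt; lra). lra.
  - rewrite He in Hnz. easy. }
exists tau. split; [|now split].
split; [|lra]. destruct T0 as [|He]; [assumption|]. rewrite <- He in Hz. easy.
Qed.

(** At the first zero [tau] of [g] on the segment from 0 to [z], Gronwall's
    argument gives a contradiction: on [[tau / 2, tau]] the logarithmic
    derivative of [|g|^2] is at least a negative constant, so [|g|^2] cannot
    reach 0. Starting at [tau / 2] avoids the singularity at the origin. The
    equation is assumed only where [g] does not vanish, because it will come
    from a quotient by [g]. *)
Lemma singular_ode_no_zero (g g1 Q : C -> C) :
  disk_deriv g g1 -> (forall z, in_disk z -> Ccont Q z) -> g 0 <> 0%C ->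
  (forall z, in_disk z -> g z <> 0%C -> (z * g1 z = Q z * g z)%C) ->
  forall z, in_disk z -> g z <> 0%C.
Proof.
intros Hg HQ Hg0 Heq z Hz Hgz.
destruct (first_zero (fun u => Cmod (g (u * z)%C))) as [tau [Ht [Htz Hb]]].
{ intros t Ht. apply Cmod_scale_cont; [exact Hz|].
  apply Cder_cont with (g1 (t * z)%C). now apply Hg, scale_disk. }
{ rewrite Cmult_0_l. intros E. apply Hg0, Cmod_eq_0, E. }
{ rewrite Cmult_1_l, Hgz. apply Cmod_0. }
apply Cmod_eq_0 in Htz.
destruct (continuity_ab_maj (fun u => Cmod (Q (u * z)%C)) 0 1) as [m [Hm _]]; [lra| |].
{ intros t Ht'. apply Cmod_scale_cont; [exact Hz|]. now apply HQ, scale_disk. }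
set (K := Cmod (Q (m * z)%C)) in *.
assert (HK : 0 <= K) by apply Cmod_ge_0.
(* [z g' = Q g / u] along the ray and [u >= tau / 2], so
   [|(|g|^2)'| <= 2 * (2 K / tau) * |g|^2]. *)
set (k := 4 * K / tau).
set (N := fun u : R => Cmod (g (u * z)%C) ^ 2).
set (N' := fun u : R => 2 * (Re (g (u * z)%C) * Re (g1 (u * z)%C * z)%C
                             + Im (g (u * z)%C) * Im (g1 (u * z)%C * z)%C)).
assert (DN : forall u, 0 <= u <= 1 -> is_derive (fun u => N u * exp (k * u)) u ((N' u + k * N u) * exp (k * u))).
{ intros u Hu.
  destruct (Rder_comp g (fun u => u * z)%C u _ _ (Hg _ (scale_disk u z Hu Hz)) (Rder_scale z u)) as [D1 D2].
  assert (DN : is_derive N u (N' u)).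
  { apply is_derive_ext with (fun u : R => Re (g (u * z)%C) ^ 2 + Im (g (u * z)%C) ^ 2).
    { intros; unfold N; symmetry; apply Cmod2_alt. }
    replace (N' u) with (plus (INR 2 * Re (g1 (u * z) * z)%C * Re (g (u * z)%C) ^ 1)
       (INR 2 * Im (g1 (u * z) * z)%C * Im (g (u * z)%C) ^ 1)).
    - apply @is_derive_plus; [exact (is_derive_pow _ 2 _ _ D1)|exact (is_derive_pow _ 2 _ _ D2)].
    - unfold N', plus; simpl. ring. }
  assert (DE : is_derive (fun u => exp (k * u)) u (k * exp (k * u))) by (auto_derive; auto; ring).
  replace ((N' u + k * N u) * exp (k * u)) with (plus (mult (N' u) (exp (k * u))) (mult (N u) (k * exp (k * u)))).
  - apply (is_derive_mult N (fun u => exp (k * u))); auto. intros; apply Rmult_comm.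
  - unfold plus, mult; simpl; ring. }
destruct (MVT_gen (fun u => N u * exp (k * u)) (tau / 2) tau (fun u => (N' u + k * N u) * exp (k * u)))
  as [c [Hc1 Hc2]].
{ intros u Hu. rewrite Rmin_left, Rmax_right in Hu by lra. apply DN; lra. }
{ intros u Hu. rewrite Rmin_left, Rmax_right in Hu by lra.
  apply continuity_pt_filterlim. apply (@ex_derive_continuous R_AbsRing R_NormedModule (fun u => N u * exp (k * u))).
  exists ((N' u + k * N u) * exp (k * u)); apply DN; lra. }
rewrite Rmin_left, Rmax_right in Hc1 by lra.
assert (Nt : N tau = 0) by (unfold N; rewrite Htz, Cmod_0; ring).
assert (Nh : 0 < N (tau / 2)).
{ unfold N. apply pow_lt. assert (T := Hb (tau / 2) ltac:(lra)). generalize (Cmod_ge_0 (g (RtoC (tau / 2) * z)%C)); lra. }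
assert (Hpos : 0 <= N' c + k * N c).
{ destruct (Req_dec c tau) as [->|Hne].
  - rewrite Nt. unfold N'. rewrite Htz. unfold Re, Im; simpl. lra.
  - assert (Hcz : g (c * z)%C <> 0%C).
    { intros E. apply (Hb c); [lra|]. rewrite E. apply Cmod_0. }
    assert (Hcd : in_disk (c * z)) by (apply scale_disk; [lra|exact Hz]).
    assert (Eq := Heq _ Hcd Hcz).
    assert (HQc : Cmod (Q (c * z)%C) <= K) by (apply Hm; lra).
    assert (Hv : Cmod (g1 (c * z) * z)%C <= 2 * K / tau * Cmod (g (c * z)%C)).
    { apply Rmult_le_reg_l with c; [lra|].
      replace (c * Cmod (g1 (c * z) * z)%C) with (Cmod (c * z * g1 (c * z))%C).
      2:{ replace (c * z * g1 (c * z))%C with (c * (g1 (c * z) * z))%C by ring.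
          rewrite (Cmod_mult (RtoC c)), Cmod_R, Rabs_pos_eq by lra. reflexivity. }
      rewrite Eq, Cmod_mult. assert (G0 := Cmod_ge_0 (g (c * z)%C)).
      rewrite <- Rmult_assoc. apply Rmult_le_compat_r; [lra|].
      apply Rle_trans with K; [lra|]. apply Rmult_le_reg_r with tau; [lra|].
      replace (c * (2 * K / tau) * tau) with (2 * c * K) by (field; lra). nra. }
    assert (Hre : - N' c <= 2 * (Cmod (g (c * z)%C) * Cmod (g1 (c * z) * z)%C)).
    { unfold N'. set (a := g (c * z)%C). set (b := (g1 (c * z) * z)%C).
      assert (T := re_le_Cmod (a * Cconj b)%C). rewrite Cmod_mult, Cmod_conj in T.
      assert (T' := Rle_abs (- Re (a * Cconj b)%C)). rewrite Rabs_Ropp in T'.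
      replace (Re (a * Cconj b)%C) with (Re a * Re b + Im a * Im b) in * by (unfold Re, Im; simpl; ring).
      lra. }
    assert (k * N c = 2 * (Cmod (g (c * z)%C) * (2 * K / tau * Cmod (g (c * z)%C)))).
    { unfold k, N. field; lra. }
    assert (Cmod (g (c * z)%C) * Cmod (g1 (c * z) * z)%C <= Cmod (g (c * z)%C) * (2 * K / tau * Cmod (g (c * z)%C))).
    { apply Rmult_le_compat_l; [apply Cmod_ge_0|exact Hv]. }
    lra. }
rewrite Nt in Hc2.
assert (E1 := exp_pos (k * (tau / 2))). assert (E2 := exp_pos (k * c)).
assert (0 < N (tau / 2) * exp (k * (tau / 2))) by nra.
assert (0 <= (N' c + k * N c) * exp (k * c)) by nra.
assert (0 <= (N' c + k * N c) * exp (k * c) * (tau - tau / 2)) by (apply Rmult_le_pos; lra).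
lra.
Qed.

(** * The upper bound *)

Lemma disk_deriv_unique (f g f' g' : C -> C) :
  (forall z, in_disk z -> f z = g z) -> disk_deriv f f' -> disk_deriv g g' ->
  forall z, in_disk z -> f' z = g' z.
Proof.
intros E Hf Hg z Hz. apply (Cder_unique g z); [|now apply Hg].
apply Cder_ext_disk with f; auto.
Qed.

Lemma disk_deriv_C_derive (f f' : C -> C) (z : C) :
  disk_deriv f f' -> in_disk z -> C_derive f z = f' z.
Proof. intros H Hz. apply is_C_derive_unique, Cder_is_derive, H, Hz. Qed.

Lemma smooth_C_derive (n : nat) (f : C -> C) : smooth (S n) f -> smooth n (C_derive f).
Proof.
intros [f' [H1 H2]]. apply smooth_ext with f'; [|exact H2].
intros z Hz. symmetry. now apply disk_deriv_C_derive.
Qed.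

Lemma disk_deriv_C_derive2 (f f' f'' : C -> C) (z : C) :
  disk_deriv f f' -> disk_deriv f' f'' -> in_disk z -> C_derive (C_derive f) z = f'' z.
Proof.
intros H H' Hz. apply is_C_derive_unique, Cder_is_derive.
apply Cder_ext_disk with f'; [|exact Hz|now apply H'].
intros w Hw. symmetry. now apply disk_deriv_C_derive.
Qed.

(** Differentiating [p = q_s o omega] gives [omega' s p = p' (1 - omega)]. The
    right side and [p] are as smooth as [p'] and [omega], and [p] has no zero,
    so [omega] gains one derivative at each step. *)
Lemma subordinating_function_smooth (s : R) (p omega : C -> C) :
  0 < s -> holomorphic_on_disk omega -> (forall z, in_disk z -> in_disk (omega z)) ->
  (forall z, in_disk z -> p z = q s (omega z)) -> (forall n, smooth n p) ->
  (forall n, smooth n omega) /\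
  (forall omega1 p1 : C -> C, disk_deriv omega omega1 -> disk_deriv p p1 ->
     forall z, in_disk z -> (omega1 z * (s * p z) = p1 z * (1 - omega z))%C).
Proof.
intros Hs Hh Hd Hp Hsm.
assert (Hs0 : RtoC s <> 0%C) by (apply RtoC_neq_0; lra).
assert (Rel : forall omega1 p1 : C -> C, disk_deriv omega omega1 -> disk_deriv p p1 ->
     forall z, in_disk z -> (omega1 z * (s * p z) = p1 z * (1 - omega z))%C).
{ intros w1 p1 Hw1 Hp1 z Hz.
  assert (E : p1 z = (s * q s (omega z) / (1 - omega z) * w1 z)%C).
  { apply (disk_deriv_unique p (fun z => q s (omega z)) p1 (fun z => s * q s (omega z) / (1 - omega z) * w1 z)%C); auto.
    intros x Hx. apply (Cder_comp (q s) omega); [apply Cder_q|]; auto. }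
  rewrite E, Hp by exact Hz. field. apply disk_1m_neq_0; auto. }
split; [|exact Rel].
assert (Hder : disk_deriv omega (C_derive omega)).
{ intros z Hz. apply Cder_is_derive, C_derive_correct; [exact z|apply Hh, Hz]. }
assert (Hpd : disk_deriv p (C_derive p)).
{ destruct (Hsm 1%nat) as [p1 [H _]]. intros z Hz.
  rewrite (disk_deriv_C_derive p p1 z H Hz). now apply H. }
assert (Hpn : forall z, in_disk z -> (s * p z <> 0)%C).
{ intros z Hz. apply Cmult_neq_0; [exact Hs0|]. rewrite Hp by exact Hz. apply q_nz. }
induction n as [|n IH]; [easy|].
exists (fun z => C_derive p z * (1 + - omega z) * / (s * p z))%C. split.
- intros z Hz. replace (C_derive p z * (1 + - omega z) * / (s * p z))%C with (C_derive omega z); [now apply Hder|].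
  assert (R := Rel _ _ Hder Hpd z Hz).
  replace (C_derive p z * (1 + - omega z))%C with (C_derive p z * (1 - omega z))%C by ring.
  rewrite <- R. rewrite <- Cmult_assoc, Cinv_r by auto. ring.
- apply smooth_mult.
  + apply smooth_mult; [apply smooth_C_derive, Hsm|].
    apply smooth_plus; [apply smooth_const|apply smooth_opp, IH].
  + apply smooth_inv; [exact Hpn|]. apply smooth_mult; [apply smooth_const|apply Hsm].
Qed.

(** With [g = h'] and [p = 1 + z g' / g], the identities [p g = g + z g'] and
    [omega' s p = p' (1 - omega)] are differentiated at the origin until the
    second-order coefficients of [omega] appear. *)
Lemma coeffs_of_omega (s : R) (h : C -> C) (d : nat -> C) :
  0 < s -> class_CV_hpl s h -> normalized_expansion h d ->
  exists c1 c2 : C, Cmod c2 <= 1 - Cmod c1 ^ 2 /\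
    d 2%nat = (s / 2 * c1)%C /\
    d 3%nat = (s / 6 * (c2 + (3 * s + 1) / 2 * c1 ^ 2))%C.
Proof.
intros Hs [_ [omega [Hh [Hd [H0 Hsub]]]]] [_ [d1 Hps]].
assert (Hc := disk_coeffs_of_pseries d h Hps).
set (g := PS (dseq d)). set (g1 := PS (dseq (dseq d))).
set (g2 := PS (dseq (dseq (dseq d)))). set (g3 := PS (dseq (dseq (dseq (dseq d))))).
assert (Hc1 := disk_coeffs_dseq _ Hc). assert (Hc2 := disk_coeffs_dseq _ Hc1). assert (Hc3 := disk_coeffs_dseq _ Hc2).
assert (Dh : disk_deriv h g).
{ intros z Hz. apply Cder_ext_disk with (PS d); [|exact Hz|now apply Cder_PS].
  intros w Hw. symmetry. now apply is_pseries_PS_unique, Hps. }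
assert (Dg : disk_deriv g g1) by (intros z Hz; now apply Cder_PS).
assert (Dg1 : disk_deriv g1 g2) by (intros z Hz; now apply Cder_PS).
assert (Dg2 : disk_deriv g2 g3) by (intros z Hz; now apply Cder_PS).
assert (Hg0 : g 0 = 1%C).
{ unfold g. rewrite PS_0 by exact Hc1. unfold dseq. rewrite d1. simpl. ring. }
assert (Hg10 : g1 0 = (2 * d 2%nat)%C).
{ unfold g1. rewrite PS_0 by exact Hc2. unfold dseq. rewrite !S_INR, !RtoC_plus. simpl. ring. }
assert (Hg20 : g2 0 = (6 * d 3%nat)%C).
{ unfold g2. rewrite PS_0 by exact Hc3. unfold dseq. rewrite !S_INR, !RtoC_plus. simpl. ring. }
set (p := (fun z => 1 + z * g1 z / g z)%C).
assert (Hpq : forall z, in_disk z -> p z = q s (omega z)).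
{ intros z Hz. rewrite <- Hsub by exact Hz. unfold p.
  now rewrite (disk_deriv_C_derive2 h g g1 z Dh Dg Hz), (disk_deriv_C_derive h g z Dh Hz). }
assert (Hgn : forall z, in_disk z -> g z <> 0%C).
{ apply (singular_ode_no_zero g g1 (fun z => q s (omega z) - 1)%C Dg).
  - intros z Hz.
    destruct (Hh z Hz) as [l Hl]. apply Cder_is_derive in Hl.
    eapply Cder_cont, Cder_minus; [|apply Cder_const].
    apply (Cder_comp (q s) omega); [apply Cder_q; auto|exact Hl].
  - rewrite Hg0. apply RtoC_neq_0; lra.
  - intros z Hz Hn. rewrite <- Hpq by exact Hz. unfold p. field. exact Hn. }
assert (Hps' : forall n, smooth n p).
{ intros n. unfold p. apply smooth_plus; [apply smooth_const|].
  apply smooth_mult; [apply smooth_mult; [apply smooth_id|now apply smooth_PS]|].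
  apply smooth_inv; [exact Hgn|now apply smooth_PS]. }
destruct (subordinating_function_smooth s p omega Hs Hh Hd Hpq Hps') as [Hom Rel].
destruct (Hom 4%nat) as [w1 [W1 [w2 [W2 [w3 [W3 [w4 [W4 _]]]]]]]].
destruct (Hps' 2%nat) as [p1 [P1 [p2 [P2 _]]]].
assert (S := schwarz_coeffs omega w1 w2 w3 w4 W1 W2 W3 W4 Hd H0).
exists (w1 0), (w2 0 / 2)%C. split; [exact S|].
assert (D0 := in_disk_0).
assert (Did : disk_deriv (fun z => z) (fun _ => RtoC 1)) by (intros z _; apply Cder_id).
assert (Dc : forall c : C, disk_deriv (fun _ => c) (fun _ => RtoC 0)) by (intros c z _; apply Cder_const).
assert (Dp : forall a b a' b' : C -> C, disk_deriv a a' -> disk_deriv b b' ->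
   disk_deriv (fun z => a z + b z)%C (fun z => a' z + b' z)%C) by (intros; intros z Hz; apply Cder_plus; auto).
assert (Dm : forall a b a' b' : C -> C, disk_deriv a a' -> disk_deriv b b' ->
   disk_deriv (fun z => a z * b z)%C (fun z => a' z * b z + a z * b' z)%C) by (intros; intros z Hz; apply Cder_mult; auto).
assert (Dmi : forall a b a' b' : C -> C, disk_deriv a a' -> disk_deriv b b' ->
   disk_deriv (fun z => a z - b z)%C (fun z => a' z - b' z)%C) by (intros; intros z Hz; apply Cder_minus; auto).
assert (E0 : forall z, in_disk z -> (p z * g z = g z + z * g1 z)%C).
{ intros z Hz. unfold p. field. auto. }
assert (E1 := disk_deriv_unique _ _ _ _ E0 (Dm _ _ _ _ P1 Dg) (Dp _ _ _ _ Dg (Dm _ _ _ _ Did Dg1))).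
assert (E2 := disk_deriv_unique _ _ _ _ E1
  (Dp _ _ _ _ (Dm _ _ _ _ P2 Dg) (Dm _ _ _ _ P1 Dg1))
  (Dp _ _ _ _ Dg1 (Dp _ _ _ _ (Dm _ _ _ _ (Dc 1%C) Dg1) (Dm _ _ _ _ Did Dg2)))).
assert (F0 := Rel w1 p1 W1 P1).
assert (F1 := disk_deriv_unique _ _ _ _ F0
  (Dm _ _ _ _ W2 (Dm _ _ _ _ (Dc s) P1)) (Dm _ _ _ _ P2 (Dmi _ _ _ _ (Dc 1%C) W1))).
specialize (E0 0%C D0). specialize (E1 0%C D0). specialize (E2 0%C D0).
specialize (F0 0%C D0). specialize (F1 0%C D0). cbv beta in *.
rewrite H0, Hg0, Hg10, Hg20 in *.
set (D2 := d 2%nat) in *. set (D3 := d 3%nat) in *.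
assert (Hp0 : p 0 = 1%C).
{ replace (p 0) with (p 0 * 1)%C by ring. rewrite E0. ring. }
rewrite Hp0 in *.
assert (Hp1 : p1 0 = (2 * D2)%C).
{ replace (p1 0) with (p1 0 * 1 + 1 * (2 * D2) - 2 * D2)%C by ring. rewrite E1. ring. }
rewrite Hp1 in *.
assert (Hw1 : (2 * D2 = s * w1 0)%C).
{ replace (2 * D2)%C with (2 * D2 * (1 - 0))%C by ring. rewrite <- F0. ring. }
assert (N2 : RtoC 2 <> 0%C) by (apply RtoC_neq_0; lra).
assert (N6 : RtoC 6 <> 0%C) by (apply RtoC_neq_0; lra).
assert (HD2 : D2 = (s / 2 * w1 0)%C).
{ replace D2 with ((2 * D2) / 2)%C by (field; auto). rewrite Hw1. field; auto. }
split; [exact HD2|].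
assert (Hp2 : p2 0 = (s * w2 0 + s * w1 0 * (s * w1 0) + s * w1 0 * w1 0)%C).
{ replace (p2 0) with ((p2 0 * (1 - 0) + 2 * D2 * (0 - w1 0)) + 2 * D2 * w1 0)%C by ring.
  rewrite <- F1, Hw1. ring. }
assert (H12 : (12 * D3 = p2 0 + 2 * (2 * D2) * (2 * D2))%C).
{ match type of E2 with ?l = ?r => replace (p2 0 + 2 * (2 * D2) * (2 * D2))%C with (l - 6 * D3)%C by ring; rewrite E2 end. ring. }
assert (N12 : RtoC 12 <> 0%C) by (apply RtoC_neq_0; lra).
replace D3 with ((12 * D3) / 12)%C by (field; auto).
rewrite H12, Hp2, Hw1. replace (RtoC 12) with (2 * 6)%C by ring. 
replace (RtoC 6) with (2 * 3)%C by ring.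
field.
Qed.

(** The functional equals [s / 6] times [c2 + mu c1^2], and
    [|c2| + |mu| |c1|^2 <= 1 - |c1|^2 + |mu| |c1|^2]. *)
Lemma fekete_szego_bound (s lambda : R) (h : C -> C) (d : nat -> C) :
  0 < s -> class_CV_hpl s h -> normalized_expansion h d ->
  Cmod (d 3%nat - RtoC lambda * d 2%nat ^ 2)%C <= s / 6 * Rmax 1 (Rabs ((3 * s + 1 - 3 * lambda * s) / 2)).
Proof.
intros Hs Hh Hd.
destruct (coeffs_of_omega s h d Hs Hh Hd) as [c1 [c2 [Hc [-> ->]]]].
set (mu := (3 * s + 1 - 3 * lambda * s) / 2).
replace (s / 6 * (c2 + (3 * s + 1) / 2 * c1 ^ 2) - lambda * (s / 2 * c1) ^ 2)%C
  with (RtoC (s / 6) * (c2 + RtoC mu * c1 ^ 2))%C.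
- rewrite Cmod_mult, Cmod_R, Rabs_pos_eq by lra. apply Rmult_le_compat_l; [lra|].
  eapply Rle_trans; [apply Cmod_triangle|]. rewrite Cmod_mult, Cmod_R, Cmod_pow.
  assert (M1 := Rmax_l 1 (Rabs mu)). assert (M2 := Rmax_r 1 (Rabs mu)).
  set (M := Rmax 1 (Rabs mu)) in *.
  assert (C0 := Cmod_ge_0 c2). assert (0 <= Cmod c1 ^ 2) by (apply pow_le, Cmod_ge_0). nra.
- unfold mu. apply injective_projections; simpl; field.
Qed.

(** * Mean value arguments on segments *)

Lemma segment_disk (z w : C) (u : R) :
  0 <= u <= 1 -> in_disk z -> in_disk w -> in_disk (z + u * (w - z)).
Proof.
unfold in_disk; intros Hu Hz Hw.
replace (z + u * (w - z))%C with (RtoC (1 - u) * z + RtoC u * w)%C by (rewrite RtoC_minus; ring).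
eapply Rle_lt_trans; [apply Cmod_triangle|].
rewrite !Cmod_mult, !Cmod_R, !Rabs_pos_eq by lra.
destruct (Req_dec u 0) as [->|Hu0]; [lra|].
generalize (Cmod_ge_0 z) (Cmod_ge_0 w). nra.
Qed.

Lemma segment_mvt (F F' : C -> C) (k z w : C) :
  disk_deriv F F' -> in_disk z -> in_disk w ->
  exists c, 0 < c < 1 /\ Re (k * (F w - F z))%C = Re (k * (F' (z + c * (w - z)) * (w - z)))%C.
Proof.
intros HF Hz Hw. set (v := (w - z)%C).
destruct (MVT_cor2 (fun u : R => Re (k * F (z + u * v))%C)
  (fun u : R => Re (k * (F' (z + u * v) * v))%C) 0 1 Rlt_0_1) as [c [Hc1 Hc2]].
{ intros u Hu. apply is_derive_Reals.
  assert (Hd := segment_disk z w u Hu Hz Hw). fold v in Hd.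
  destruct (Rder_comp (fun x => k * F x)%C (fun u => z + RtoC u * v)%C u _ _
    (Cder_mult _ _ _ _ _ (Cder_const k _) (HF _ Hd)) (Rder_ray z v u)) as [K _].
  cbv beta in K.
  replace (k * (F' (z + u * v) * v))%C with ((0 * F (z + u * v) + k * F' (z + u * v)) * v)%C by ring.
  exact K. }
exists c. split; [exact Hc2|].
replace (z + 1 * v)%C with w in Hc1 by (unfold v; ring).
replace (z + 0 * v)%C with z in Hc1 by ring.
rewrite Rminus_0_r, Rmult_1_r in Hc1. rewrite <- Hc1. unfold Re; simpl; ring.
Qed.

(** The Noshiro-Warschawski criterion: the real part of
    [conj (w - z) * f] strictly increases along the segment from [z] to [w]. *)
Lemma noshiro_warschawski (f f' : C -> C) :
  disk_deriv f f' -> (forall z, in_disk z -> 0 < Re (f' z)) -> univalent_on_disk f.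
Proof.
intros Hf Hpos z w Hz Hw Heq.
destruct (Req_dec (Cmod (w - z)) 0) as [E|Hne].
{ apply Cmod_eq_0 in E. replace w with (z + (w - z))%C by ring. rewrite E. ring. }
exfalso.
destruct (segment_mvt f f' (Cconj (w - z)) z w Hf Hz Hw) as [c [Hc E]].
assert (P := Hpos _ (segment_disk z w c ltac:(lra) Hz Hw)).
set (x := f' (z + c * (w - z))%C) in *. set (v := (w - z)%C) in *.
replace (Re (Cconj v * (x * v))%C) with (Cmod v ^ 2 * Re x) in E
  by (rewrite Cmod2_alt; unfold Re, Im; simpl; ring).
rewrite Heq in E. replace (Re (Cconj v * (f w - f w))%C) with 0 in E by (unfold Re; simpl; ring).
assert (0 < Cmod v ^ 2) by (apply pow_lt; generalize (Cmod_ge_0 v); lra).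
nra.
Qed.

Lemma ray_mvt (F F' : C -> C) (k z : C) :
  disk_deriv F F' -> in_disk z ->
  exists c, 0 < c < 1 /\ c * Re (k * (F z - F 0))%C = Re (k * ((c * z) * F' (c * z)))%C.
Proof.
intros HF Hz. destruct (segment_mvt F F' k 0%C z HF in_disk_0 Hz) as [c [Hc E]].
exists c; split; [exact Hc|]. rewrite E.
replace (0 + c * (z - 0))%C with (c * z)%C by ring.
unfold Re; simpl. ring.
Qed.

(** The equations solved below come multiplied by [z]; the mean value theorem
    only looks at interior points of a segment, where this factor can be
    cancelled. *)
Lemma disk_constant (F F' : C -> C) :
  disk_deriv F F' -> (forall z, in_disk z -> (z * F' z = 0)%C) ->
  forall z, in_disk z -> F z = F 0.
Proof.
intros HF H z Hz.
assert (K : forall k : C, Re (k * (F z - F 0))%C = 0).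
{ intros k. destruct (ray_mvt F F' k z HF Hz) as [c [Hc E]].
  rewrite H in E by (apply scale_disk; [lra|exact Hz]).
  apply Rmult_eq_reg_l with c; [|lra]. rewrite E. unfold Re; simpl; ring. }
assert (K1 := K 1%C). assert (K2 := K (- Ci)%C).
apply injective_projections; unfold Re in *; simpl in *; lra.
Qed.

(** * Exponentials of power series *)

Lemma csum_RtoC (u : nat -> R) (n : nat) : csum (fun k => RtoC (u k)) n = RtoC (sum_f_R0 u n).
Proof. induction n as [|n IH]; [reflexivity|]. simpl. now rewrite IH, RtoC_plus. Qed.

Lemma csum_ext (u v : nat -> C) (n : nat) :
  (forall k, (k <= n)%nat -> u k = v k) -> csum u n = csum v n.
Proof.
induction n as [|n IH]; intros H; simpl; [apply H; lia|].
rewrite IH, H; auto.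
Qed.

Lemma csum_scal (c : C) (u : nat -> C) (n : nat) : (csum (fun k => u k * c) n = csum u n * c)%C.
Proof. induction n as [|n IH]; simpl; [reflexivity|rewrite IH; ring]. Qed.

(** Course-of-values recursion: [exp_approx b n] is the wanted sequence up to
    index [n]. The recursion states that [e = exp_coeff b] satisfies
    [(n + 1) e_(n+1) = sum of b_(k+1) e_(n-k)], the equation [y' = L' y] in
    coefficients, where [z L'] has coefficients [b_1, b_2, ...]. *)
Fixpoint exp_approx (b : nat -> R) (n k : nat) : R :=
  match n with
  | O => 1
  | S m => if (k <=? m)%nat then exp_approx b m k
           else sum_f_R0 (fun j => b (S j) * exp_approx b m (m - j)) m / INR (S m)
  end.

Definition exp_coeff (b : nat -> R) (n : nat) : R := exp_approx b n n.

Lemma exp_approx_stable (b : nat -> R) (n k : nat) :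
  (k <= n)%nat -> exp_approx b n k = exp_coeff b k.
Proof.
induction n as [|n IH]; intros H.
- replace k with 0%nat by lia. reflexivity.
- destruct (Nat.eq_dec k (S n)) as [->|Hne]; [reflexivity|].
  cbn [exp_approx]. rewrite (proj2 (Nat.leb_le k n)) by lia. apply IH; lia.
Qed.

Lemma exp_coeff_rec (b : nat -> R) (n : nat) :
  INR (S n) * exp_coeff b (S n) = sum_f_R0 (fun j => b (S j) * exp_coeff b (n - j)) n.
Proof.
unfold exp_coeff at 1. cbn [exp_approx]. rewrite (proj2 (Nat.leb_gt (S n) n)) by lia.
rewrite (sum_eq _ (fun j => b (S j) * exp_coeff b (n - j))).
- field. apply not_0_INR; lia.
- intros j Hj. rewrite exp_approx_stable by lia. reflexivity.
Qed.

(** [(n + 1) e_(n+1)] is a sum of [n + 1] products of numbers in [[0, 1]]. *)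
Lemma exp_coeff_bounds (b : nat -> R) :
  (forall n, 0 <= b n <= 1) -> forall n, 0 <= exp_coeff b n <= 1.
Proof.
intros Hb n. induction n as [n IH] using Wf_nat.lt_wf_ind.
destruct n as [|n]; [unfold exp_coeff; simpl; lra|].
assert (R := exp_coeff_rec b n).
assert (HS : 0 < INR (S n)) by (apply lt_0_INR; lia).
assert (T : forall j, (j <= n)%nat -> 0 <= b (S j) * exp_coeff b (n - j) <= 1).
{ intros j Hj. specialize (Hb (S j)). specialize (IH (n - j)%nat ltac:(lia)). split; nra. }
assert (L : 0 <= sum_f_R0 (fun j => b (S j) * exp_coeff b (n - j)) n <= INR (S n)).
{ split.
  - apply cond_pos_sum. intros j. specialize (Hb (S j)).
    assert (0 <= exp_coeff b (n - j)) by (apply IH; lia). nra.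
  - rewrite <- (Rmult_1_l (INR (S n))), <- sum_cte. apply sum_Rle. intros j Hj. now apply T. }
rewrite <- R in L. split; nra.
Qed.

Lemma disk_coeffs_bounded (a : nat -> R) :
  (forall n, 0 <= a n <= 1) -> disk_coeffs (fun n => RtoC (a n)).
Proof.
intros H r Hr. exists 1. intros n. rewrite Cmod_R, Rabs_pos_eq by apply H.
assert (0 <= r ^ n) by (apply pow_le; lra).
assert (r ^ n <= 1) by (rewrite <- (pow1 n); apply pow_incr; lra).
specialize (H n). nra.
Qed.

(** Coefficients of the primitive that vanishes at the origin. *)
Definition prim (a : nat -> R) (n : nat) : R :=
  match n with O => 0 | S k => a k / INR (S k) end.

Lemma prim_bounds (a : nat -> R) : (forall n, 0 <= a n <= 1) -> forall n, 0 <= prim a n <= 1.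
Proof.
intros H [|n]; cbn [prim]; [lra|]. specialize (H n).
assert (1 <= INR (S n)) by (rewrite S_INR; generalize (pos_INR n); lra).
split; [apply Rmult_le_pos; [lra|left; apply Rinv_0_lt_compat; lra]|].
apply Rmult_le_reg_r with (INR (S n)); [lra|].
replace (a n / INR (S n) * INR (S n)) with (a n) by (field; lra). lra.
Qed.

Lemma dseq_prim (a : nat -> R) (n : nat) : dseq (fun k => RtoC (prim a k)) n = RtoC (a n).
Proof.
unfold dseq. cbn [prim]. rewrite <- RtoC_mult. f_equal. field. apply not_0_INR; lia.
Qed.

Lemma PS_ext (a b : nat -> C) (z : C) : (forall n, a n = b n) -> PS a z = PS b z.
Proof. intros H; apply CS_ext; intros; now rewrite H. Qed.

Lemma disk_deriv_prim (a : nat -> R) :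
  (forall n, 0 <= a n <= 1) ->
  disk_deriv (PS (fun n => RtoC (prim a n))) (PS (fun n => RtoC (a n))).
Proof.
intros H z Hz. rewrite <- (PS_ext _ _ z (dseq_prim a)).
apply Cder_PS; [|exact Hz]. now apply disk_coeffs_bounded, prim_bounds.
Qed.

(** Both sides solve [y' = L' y] with [y 0 = 1]; by the Cauchy product the
    recursion for the coefficients is this equation, and [y Cexp (- L)] is
    constant. *)
Lemma exp_series_sum (b : nat -> R) :
  (forall n, 0 <= b n <= 1) -> forall z, in_disk z ->
  PS (fun n => RtoC (exp_coeff b n)) z = Cexp (PS (fun n => RtoC (prim (fun k => b (S k)) n)) z).
Proof.
intros Hb.
set (b' := fun k => b (S k)). assert (Hb' : forall n, 0 <= b' n <= 1) by (intros; apply Hb).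
set (e := fun n => RtoC (exp_coeff b n)). set (L := PS (fun n => RtoC (prim b' n))).
set (L' := PS (fun n => RtoC (b' n))).
assert (He : disk_coeffs e) by (apply disk_coeffs_bounded, exp_coeff_bounds, Hb).
assert (DL : disk_deriv L L') by (apply disk_deriv_prim, Hb').
assert (ODE : forall z, in_disk z -> PS (dseq e) z = (L' z * PS e z)%C).
{ intros z Hz. unfold L', PS. rewrite <- CS_mult.
  2:{ apply disk_coeffs_abs; [apply disk_coeffs_bounded, Hb'|exact Hz]. }
  2:{ now apply disk_coeffs_abs. }
  apply CS_ext. intros n. unfold dseq, e. rewrite <- RtoC_mult, exp_coeff_rec, <- csum_RtoC, <- csum_scal.
  apply csum_ext. intros k Hk. rewrite RtoC_mult.
  replace n with (k + (n - k))%nat at 2 by lia. rewrite Cpow_add_r. unfold b'. ring. }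
set (F := fun z => (PS e z * Cexp (- L z))%C).
assert (DF : disk_deriv F (fun z => PS (dseq e) z * Cexp (- L z) + PS e z * (Cexp (- L z) * - L' z))%C).
{ intros z Hz. apply (Cder_mult (PS e) (fun z => Cexp (- L z))); [now apply Cder_PS|].
  apply (Cder_comp Cexp (fun z => - L z)%C); [apply Cder_Cexp|]. now apply Cder_opp, DL. }
assert (HF := disk_constant F _ DF).
assert (HF' : forall z, in_disk z -> F z = F 0).
{ apply HF. intros z Hz. rewrite ODE by exact Hz. ring. }
assert (F0 : F 0 = 1%C).
{ unfold F, L. rewrite !PS_0 by (try assumption; apply disk_coeffs_bounded, prim_bounds, Hb').
  unfold e, exp_coeff. simpl. replace (- 0)%C with (RtoC 0) by ring. rewrite Cexp_0. ring. }
intros z Hz. specialize (HF' z Hz). rewrite F0 in HF'. unfold F in HF'.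
replace (PS e z) with (PS e z * Cexp (- L z + L z))%C.
- rewrite Cexp_plus, Cmult_assoc, HF'. ring.
- replace (- L z + L z)%C with (RtoC 0) by ring. rewrite Cexp_0; ring.
Qed.

(** * The power series of q_s(z^m) *)

Fixpoint binom_coeff (s : R) (n : nat) : R :=
  match n with O => 1 | S k => (INR k + s) / INR (S k) * binom_coeff s k end.

Definition q_coeff (s : R) (m n : nat) : R :=
  if (n mod m =? 0)%nat then binom_coeff s (n / m) else 0.

Lemma binom_coeff_bounds (s : R) (n : nat) : 0 < s <= 1 -> 0 <= binom_coeff s n <= 1.
Proof.
intros Hs. induction n as [|n IH]; cbn [binom_coeff]; [lra|].
assert (Hn := pos_INR n). rewrite S_INR.
assert (0 <= (INR n + s) / (INR n + 1) <= 1).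
{ split; [apply Rmult_le_pos; [lra|left; apply Rinv_0_lt_compat; lra]|].
  apply Rmult_le_reg_r with (INR n + 1); [lra|].
  replace ((INR n + s) / (INR n + 1) * (INR n + 1)) with (INR n + s) by (field; lra). lra. }
split; nra.
Qed.

Lemma q_coeff_bounds (s : R) (m n : nat) : 0 < s <= 1 -> 0 <= q_coeff s m n <= 1.
Proof.
intros Hs. unfold q_coeff. destruct (n mod m =? 0)%nat; [now apply binom_coeff_bounds|lra].
Qed.

Lemma q_coeff_rec (s : R) (m n : nat) : (0 < m)%nat ->
  INR (n + m) * q_coeff s m (n + m) = (INR n + INR m * s) * q_coeff s m n.
Proof.
intros Hm. unfold q_coeff.
assert (Em : ((n + m) mod m = n mod m)%nat).
{ rewrite <- (Nat.Div0.mod_add n 1 m). f_equal; lia. }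
assert (Ed : ((n + m) / m = n / m + 1)%nat).
{ rewrite <- Nat.div_add by lia. f_equal; lia. }
rewrite Em, Ed.
destruct (n mod m =? 0)%nat eqn:E; [|ring].
apply Nat.eqb_eq in E. assert (D := Nat.div_mod_eq n m). rewrite E in D.
set (k := (n / m)%nat) in *. replace n with (m * k)%nat by lia.
rewrite Nat.add_1_r. cbn [binom_coeff]. rewrite plus_INR, mult_INR, S_INR.
assert (Hk := pos_INR k). field. lra.
Qed.

Lemma q_coeff_small (s : R) (m n : nat) : (0 < n < m)%nat -> q_coeff s m n = 0.
Proof.
intros H. unfold q_coeff. rewrite Nat.mod_small by lia.
destruct n; [lia|reflexivity].
Qed.

Lemma CS_shift (u : nat -> C) (m : nat) :
  abs_conv u -> (forall k, (k < m)%nat -> u k = 0%C) -> CS u = CS (fun n => u (n + m)%nat).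
Proof.
intros Hu. induction m as [|m IH]; intros H.
- apply CS_ext. intros; f_equal; lia.
- rewrite IH by (intros; apply H; lia).
  rewrite CS_incr_1.
  + simpl. rewrite (H m) by lia. rewrite Cplus_0_l. apply CS_ext. intros; f_equal; lia.
  + clear IH H. induction m as [|m IH].
    * eapply ex_series_ext; [|exact Hu]. intros; simpl; do 2 f_equal; lia.
    * apply abs_conv_incr_1 in IH. eapply ex_series_ext; [|exact IH].
      intros; simpl; do 2 f_equal; lia.
Qed.

Lemma pow_disk (m : nat) (z : C) : (0 < m)%nat -> in_disk z -> in_disk (z ^ m).
Proof.
intros Hm Hz. unfold in_disk in *. rewrite Cmod_pow.
assert (Z := Cmod_ge_0 z). destruct m as [|m]; [lia|]. simpl.
assert (0 <= Cmod z ^ m) by (now apply pow_le).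
assert (Cmod z ^ m <= 1) by (rewrite <- (pow1 m); apply pow_incr; lra). nra.
Qed.

Lemma pow_0_pos (m : nat) : (0 < m)%nat -> (0 ^ m)%C = 0%C.
Proof. destruct m; [lia|]. intros _. simpl. ring. Qed.

Definition dpow (m : nat) (z : C) : C := (INR m * z ^ pred m)%C.

Lemma disk_deriv_pow (m : nat) : (0 < m)%nat -> disk_deriv (fun z => z ^ m)%C (dpow m).
Proof. destruct m as [|m]; [lia|]. intros _ z _. apply Cder_pow. Qed.

Lemma mult_id_dpow (m : nat) (z : C) : (0 < m)%nat -> (z * dpow m z = INR m * z ^ m)%C.
Proof. destruct m as [|m]; [lia|]. intros _. unfold dpow. simpl pred. rewrite Cpow_S. ring. Qed.

(** The recursion [q_coeff_rec] in terms of sums: the left side loses its first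
    [m] terms, which vanish, and the rest is [z^m] times a series. *)
Lemma q_series_euler_identity (s : R) (m : nat) (z : C) :
  0 < s <= 1 -> (0 < m)%nat -> in_disk z ->
  let b := fun n => RtoC (q_coeff s m n) in
  (z * PS (dseq b) z = z ^ m * (z * PS (dseq b) z + RtoC (INR m * s) * PS b z))%C.
Proof.
intros Hs Hm Hz b.
assert (Hb : disk_coeffs b) by (apply disk_coeffs_bounded; intros; now apply q_coeff_bounds).
assert (A1 : abs_conv (fun n => dseq b n * z ^ n)%C) by (apply disk_coeffs_abs; [now apply disk_coeffs_dseq|exact Hz]).
assert (A2 : abs_conv (fun n => b n * z ^ n)%C) by now apply disk_coeffs_abs.
assert (A3 : abs_conv (fun n => INR n * b n * z ^ n)%C).
{ apply abs_conv_incr_1. eapply ex_series_ext; [|exact (abs_conv_scal z _ A1)].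
  intros n. unfold dseq. cbv beta. f_equal. rewrite Cpow_S. ring. }
assert (E : (z * PS (dseq b) z)%C = CS (fun n => INR n * b n * z ^ n)%C).
{ unfold PS. rewrite <- CS_scal by exact A1. rewrite (CS_incr_1 (fun n => INR n * b n * z ^ n)%C) by exact A3.
  replace (INR 0 * b 0%nat * z ^ 0)%C with (RtoC 0) by (simpl; ring). rewrite Cplus_0_l.
  apply CS_ext. intros n. unfold dseq. rewrite Cpow_S. ring. }
rewrite E at 1. rewrite (CS_shift _ m A3).
- rewrite E. unfold PS. rewrite <- CS_scal by exact A2.
  rewrite <- CS_plus by (try assumption; now apply abs_conv_scal).
  rewrite <- CS_scal by (apply abs_conv_plus; [exact A3|now apply abs_conv_scal]).
  apply CS_ext. intros n. unfold b. rewrite <- RtoC_mult, q_coeff_rec by exact Hm.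
  rewrite Cpow_add_r, RtoC_mult, RtoC_plus. ring.
- intros k Hk. destruct (Nat.eq_dec k 0) as [->|Hk0]; [simpl; ring|].
  unfold b. rewrite q_coeff_small by lia. ring.
Qed.

(** The quotient of the series by [q_s (z^m)] has zero derivative, since both
    satisfy [(1 - z^m) z y' = m s z^m y]. *)
Lemma q_series_sum (s : R) (m : nat) : 0 < s <= 1 -> (0 < m)%nat ->
  forall z, in_disk z -> PS (fun n => RtoC (q_coeff s m n)) z = q s (z ^ m)%C.
Proof.
intros Hs Hm. set (b := fun n => RtoC (q_coeff s m n)).
assert (Hb : disk_coeffs b) by (apply disk_coeffs_bounded; intros; now apply q_coeff_bounds).
set (X := fun z => Cexp (RtoC s * Cln (1 - z ^ m))%C).
assert (DX : disk_deriv X (fun z => X z * (0 * Cln (1 - z ^ m) + s * (- / (1 - z ^ m) * dpow m z)))%C).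
{ intros z Hz. apply (Cder_comp Cexp (fun z => RtoC s * Cln (1 - z ^ m))%C); [apply Cder_Cexp|].
  apply (Cder_mult (fun _ => RtoC s) (fun z => Cln (1 - z ^ m))%C); [apply Cder_const|].
  apply (Cder_comp (fun w => Cln (1 - w)) (fun z => z ^ m)%C); [apply Cder_Cln_1m, pow_disk; assumption|].
  now apply disk_deriv_pow. }
assert (HX : forall z, (q s (z ^ m) * X z = 1)%C).
{ intros z. unfold q, X. rewrite <- Cexp_plus.
  replace (- (s * Cln (1 - z ^ m)) + s * Cln (1 - z ^ m))%C with (RtoC 0) by ring. apply Cexp_0. }
assert (DF := disk_constant (fun z => PS b z * X z)%C
  (fun z => PS (dseq b) z * X z + PS b z * (X z * (0 * Cln (1 - z ^ m) + s * (- / (1 - z ^ m) * dpow m z))))%C).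
intros z Hz.
replace (PS b z) with (PS b z * X z * q s (z ^ m))%C
  by (rewrite <- Cmult_assoc, (Cmult_comm (X z)), HX; ring).
rewrite DF; [|clear z Hz; intros z Hz|clear z Hz; intros z Hz|exact Hz].
- rewrite PS_0 by exact Hb. replace (X 0) with (q s (0 ^ m)%C * X 0)%C.
  + rewrite HX. unfold b, q_coeff. rewrite Nat.Div0.mod_0_l, Nat.Div0.div_0_l. simpl. ring.
  + rewrite pow_0_pos, q_0 by exact Hm. ring.
- apply (Cder_mult (PS b) X); [now apply Cder_PS|now apply DX].
- assert (E := q_series_euler_identity s m z Hs Hm Hz). cbv zeta in E. fold b in E.
  assert (Hn := disk_1m_neq_0 _ (pow_disk m z Hm Hz)).
  assert (I := mult_id_dpow m z Hm). set (u := (z ^ m)%C) in *.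
  set (P' := PS (dseq b) z) in *. set (P := PS b z) in *.
  replace (z * (P' * X z + P * (X z * (0 * Cln (1 - u) + s * (- / (1 - u) * dpow m z)))))%C
    with (X z / (1 - u) * ((1 - u) * (z * P') - s * P * (z * dpow m z)))%C by (field; exact Hn).
  rewrite I.
  replace ((1 - u) * (z * P') - s * P * (INR m * u))%C
    with (z * P' - u * (z * P' + RtoC (INR m * s) * P))%C by (rewrite RtoC_mult; ring).
  rewrite <- E. ring.
Qed.

(** * The imaginary part of q_s *)

(** The left side increases with [s]: its derivative in [s] has the sign of
    [alpha cos (s alpha) - ln rho sin (s alpha)], and
    [ln rho <= rho - 1 <= 2 cos alpha - 1 <= cos alpha <= cos (s alpha)],
    while [sin (s alpha) <= s alpha <= alpha]. *)
Lemma sine_comparison (s rho alpha : R) :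
  0 < s <= 1 -> 0 <= alpha < PI / 2 -> 0 < rho < 2 * cos alpha ->
  0 <= exp (- (s * ln rho)) * sin (s * alpha) <= exp (- ln rho) * sin alpha.
Proof.
intros Hs Ha Hr. assert (HPI := PI_RGT_0).
assert (E := exp_pos (- (s * ln rho))).
assert (Hsin : 0 <= sin (s * alpha)) by (apply sin_ge_0; nra).
split; [nra|].
(* The exponent becomes a real variable [x] between [s] and 1. *)
set (f := fun x => exp (- (x * ln rho)) * sin (x * alpha)).
set (f' := fun x => exp (- (x * ln rho)) * (alpha * cos (x * alpha) - ln rho * sin (x * alpha))).
destruct (Rle_lt_or_eq_dec s 1 (proj2 Hs)) as [Hlt | ->].
2:{ right. do 2 f_equal; ring. }
destruct (MVT_cor2 f f' s 1 Hlt) as [c [Hc1 Hc2]].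
{ intros x _. apply is_derive_Reals. unfold f, f'. auto_derive; auto; ring. }
assert (Hx : 0 <= c * alpha <= alpha) by nra.
assert (Hcos : cos alpha <= cos (c * alpha)) by (apply cos_decr_1; lra).
assert (Hc0 : 0 < cos alpha) by lra.
assert (Hsc : 0 <= sin (c * alpha)) by (apply sin_ge_0; lra).
assert (Hs1 : sin (c * alpha) <= c * alpha).
{ destruct (Req_dec (c * alpha) 0) as [-> | ]; [rewrite sin_0; lra|]. left; apply sin_lt_x; lra. }
assert (Hln : ln rho <= cos alpha).
{ assert (ln rho <= rho - 1).
  { rewrite <- (ln_exp (rho - 1)). apply Rcomplements.ln_le; [lra|].
    generalize (exp_ineq1_le (rho - 1)). lra. }
  generalize (COS_bound alpha). lra. }
assert (K : ln rho * sin (c * alpha) <= alpha * cos (c * alpha)).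
{ apply Rle_trans with (cos (c * alpha) * sin (c * alpha)); [apply Rmult_le_compat_r; lra|].
  rewrite Rmult_comm. apply Rmult_le_compat_r; lra. }
assert (0 <= f' c).
{ unfold f'. assert (T := exp_pos (- (c * ln rho))). nra. }
assert (f s <= f 1) by nra.
unfold f in *. rewrite !Rmult_1_l in *. lra.
Qed.

(** In polar form [1 - w = rho exp (i a)] the disk is [rho < 2 cos a], which is
    the hypothesis of [sine_comparison]. The sign [eps] treats both half-planes
    at once. *)
Lemma Im_q_comparison (s eps : R) (w : C) :
  0 < s <= 1 -> (eps = 1 \/ eps = -1) -> in_disk w -> 0 <= eps * Im w ->
  0 <= eps * Im (q s w) <= eps * Im (q 1 w).
Proof.
intros Hs He Hw Hi.
assert (HX := disk_Re_1m_pos w Hw).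
set (X := Re (1 - w)%C) in *. set (Y := Im (1 - w)%C).
assert (HY : Y = - Im w) by (unfold Y, Im; simpl; ring).
set (rho := Cmod (1 - w)). set (a := atan (Y / X)).
assert (Hrho : 0 < rho) by (apply Cmod_gt_0, disk_1m_neq_0, Hw).
assert (Hq : forall t, Im (q t w) = exp (- (t * ln rho)) * sin (- (t * a))).
{ intros t. unfold q, Cexp, Cln. fold X Y rho a. unfold Re, Im; simpl.
  f_equal; [f_equal|f_equal]; ring. }
assert (Ecln := Cexp_Cln (1 - w)%C HX). unfold Cln in Ecln. fold X Y rho a in Ecln.
assert (Hcos : rho * cos a = X).
{ apply (f_equal Re) in Ecln. fold X in Ecln. rewrite <- Ecln. unfold Cexp, Re, Im; simpl.
  now rewrite exp_ln. }
assert (R2 : rho ^ 2 = X ^ 2 + Y ^ 2) by apply Cmod2_alt.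
assert (Hlt : rho < 2 * cos a).
{ assert (W2 : Cmod w ^ 2 < 1).
  { unfold in_disk in Hw. generalize (Cmod_ge_0 w). nra. }
  rewrite Cmod2_alt in W2.
  assert (EX : X = 1 - Re w) by (unfold X, Re; simpl; ring).
  apply Rmult_lt_reg_l with rho; [exact Hrho|].
  replace (rho * (2 * cos a)) with (2 * X) by (rewrite <- Hcos; ring).
  nra. }
assert (Ba := atan_bound (Y / X)). fold a in Ba.
assert (Sa : 0 <= - eps * a).
{ assert (S0 : 0 <= - eps * (Y / X)).
  { replace (- eps * (Y / X)) with ((eps * Im w) * / X) by (rewrite HY; field; lra).
    apply Rmult_le_pos; [exact Hi|left; now apply Rinv_0_lt_compat]. }
  destruct He as [-> | ->].
  - assert (a <= 0); [|lra]. unfold a. destruct (Req_dec (Y / X) 0) as [-> | ]; [rewrite atan_0; lra|].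
    left. rewrite <- atan_0. apply atan_increasing. lra.
  - assert (0 <= a); [|lra]. unfold a. destruct (Req_dec (Y / X) 0) as [-> | ]; [rewrite atan_0; lra|].
    left. rewrite <- atan_0. apply atan_increasing. lra. }
rewrite !Hq, !Rmult_1_l.
assert (K := sine_comparison s rho (- eps * a) Hs).
assert (C1 : cos (- eps * a) = cos a).
{ destruct He as [-> | ->]; [|f_equal; ring]. rewrite <- cos_neg. f_equal; ring. }
assert (S1 : forall t, eps * sin (- (t * a)) = sin (t * (- eps * a))).
{ intros t. destruct He as [-> | ->].
  - rewrite Rmult_1_l. f_equal; ring.
  - rewrite sin_neg. replace (t * (- -1 * a)) with (t * a) by ring. ring. }
rewrite C1 in K.
assert (S2 := S1 1). rewrite !Rmult_1_l in S2.
replace (eps * (exp (- (s * ln rho)) * sin (- (s * a)))) with (exp (- (s * ln rho)) * (eps * sin (- (s * a)))) by ring.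
replace (eps * (exp (- ln rho) * sin (- a))) with (exp (- ln rho) * (eps * sin (- a))) by ring.
rewrite S1, S2. apply K; [|lra].
split; [exact Sa|]. destruct He as [-> | ->]; lra.
Qed.

(** * The extremal functions *)

Lemma ray_Im_nonneg (F F' : C -> C) (eps : R) (z : C) :
  disk_deriv F F' -> in_disk z ->
  (forall t, 0 < t < 1 -> 0 <= eps * Im ((t * z) * F' (t * z))%C) ->
  0 <= eps * Im (F z - F 0)%C.
Proof.
intros HF Hz H. destruct (ray_mvt F F' (- (RtoC eps * Ci))%C z HF Hz) as [c [Hc E]].
assert (K : forall x : C, Re (- (RtoC eps * Ci) * x)%C = eps * Im x) by (intros; unfold Re, Im; simpl; ring).
rewrite !K in E. specialize (H c Hc). rewrite <- E in H.
apply Rmult_le_reg_l with c; lra.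
Qed.

Lemma q_1 (w : C) : in_disk w -> q 1 w = (/ (1 - w))%C.
Proof.
intros Hw. assert (Hn := disk_1m_neq_0 w Hw).
assert (E : (q 1 w * (1 - w) = 1)%C).
{ rewrite <- (Cexp_Cln (1 - w)) at 1 by now apply disk_Re_1m_pos.
  unfold q. rewrite <- Cexp_plus.
  replace (- (1 * Cln (1 - w)) + Cln (1 - w))%C with (RtoC 0) by ring. apply Cexp_0. }
replace (q 1 w) with (q 1 w * (1 - w) * / (1 - w))%C by (field; exact Hn).
rewrite E. ring.
Qed.

(** The power series [L] with these coefficients satisfies [z L' = q_s (z^m) - 1],
    so that [h' = Cexp L] solves [1 + z h'' / h' = q_s (z^m)]. *)
Definition log_coeff (s : R) (m n : nat) : R := prim (fun k => q_coeff s m (S k)) n.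

Section Extremal.
Variables (s : R) (m : nat).
Hypothesis (Hs : 0 < s <= 1) (Hm : (0 < m)%nat).

Let b := q_coeff s m.
Let L := PS (fun n => RtoC (log_coeff s m n)).
Let L' := PS (fun k => RtoC (b (S k))).

Lemma q_coeff_unit_interval (n : nat) : 0 <= b n <= 1.
Proof. now apply q_coeff_bounds. Qed.

Lemma disk_deriv_log_series : disk_deriv L L'.
Proof. apply (disk_deriv_prim (fun k => b (S k))). intros; apply q_coeff_unit_interval. Qed.

Lemma mult_id_log_series_deriv (z : C) : in_disk z -> (z * L' z = q s (z ^ m) - 1)%C.
Proof.
intros Hz. rewrite <- q_series_sum by assumption.
assert (A : abs_conv (fun n => RtoC (b n) * z ^ n)%C).
{ apply disk_coeffs_abs; [|exact Hz]. apply disk_coeffs_bounded, q_coeff_unit_interval. }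
assert (A' : abs_conv (fun n => RtoC (b (S n)) * z ^ n)%C).
{ apply disk_coeffs_abs; [|exact Hz]. apply (disk_coeffs_bounded (fun n => b (S n))). intros; apply q_coeff_unit_interval. }
unfold L', PS. fold b. rewrite (CS_incr_1 (fun n => RtoC (b n) * z ^ n)%C) by exact A.
replace (b 0%nat) with 1.
2:{ unfold b, q_coeff. rewrite Nat.Div0.mod_0_l, Nat.Div0.div_0_l. reflexivity. }
rewrite <- CS_scal by exact A'. simpl.
rewrite (CS_ext (fun n => z * (RtoC (b (S n)) * z ^ n))%C (fun n => RtoC (b (S n)) * (z * z ^ n))%C)
  by (intros; ring).
ring.
Qed.

Lemma log_series_0 : L 0 = 0%C.
Proof.
unfold L. rewrite PS_0; [reflexivity|]. apply disk_coeffs_bounded, prim_bounds.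
intros; apply q_coeff_unit_interval.
Qed.

(** For [s = 1] the series is [- Cln (1 - z^m) / m], whose imaginary part is
    below [PI / 2] in absolute value. Along each ray [Im_q_comparison] places
    the derivative of [Im L] between 0 and the one for [s = 1]. *)
Lemma Im_log_series_bound (z : C) : in_disk z -> Rabs (Im (L z)) < PI / 2.
Proof.
intros Hz.
(* [V] is the series for [s = 1] in closed form. *)
set (V := fun z => (- / INR m * Cln (1 - z ^ m))%C).
assert (HmR : 1 <= INR m) by (apply (le_INR 1); lia).
assert (HmC : RtoC (INR m) <> 0%C) by (apply RtoC_neq_0; lra).
set (V' := fun z => (- / INR m * (- / (1 - z ^ m) * dpow m z))%C).
assert (DV : disk_deriv V V').
{ apply disk_deriv_scal. intros x Hx.
  apply (Cder_comp (fun w => Cln (1 - w)) (fun z => z ^ m)%C); [apply Cder_Cln_1m, pow_disk; assumption|].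
  now apply disk_deriv_pow. }
assert (IV : forall x, in_disk x -> (x * V' x = q 1 (x ^ m) - 1)%C).
{ intros x Hx. assert (Hx' := pow_disk m x Hm Hx). rewrite q_1 by exact Hx'.
  assert (Hn := disk_1m_neq_0 _ Hx'). unfold V'.
  replace (x * (- / INR m * (- / (1 - x ^ m) * dpow m x)))%C
    with (/ INR m * / (1 - x ^ m) * (x * dpow m x))%C by ring.
  rewrite mult_id_dpow by exact Hm. set (u := (x ^ m)%C) in *. field. split; assumption. }
assert (V0 : V 0 = 0%C).
{ unfold V. rewrite pow_0_pos by exact Hm. unfold Cln.
  replace (1 - 0)%C with (RtoC 1) by ring. rewrite Cmod_1, ln_1. unfold Re, Im; simpl.
  unfold Rdiv. rewrite Rmult_0_l, atan_0. change (0, 0) with (RtoC 0). ring. }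
assert (VB : Rabs (Im (V z)) < PI / 2).
{ assert (B := atan_bound (Im (1 - z ^ m)%C / Re (1 - z ^ m)%C)).
  set (a := atan _) in B.
  replace (Im (V z)) with (- (/ INR m * a))
    by (unfold V; rewrite <- RtoC_inv by lra; unfold a, Cln, Im, Re; simpl; ring).
  rewrite Rabs_Ropp, Rabs_mult, (Rabs_pos_eq (/ INR m)) by (left; apply Rinv_0_lt_compat; lra).
  assert (Ha : Rabs a < PI / 2) by (apply Rabs_def1; lra).
  assert (I0 : 0 < / INR m <= 1).
  { split; [apply Rinv_0_lt_compat; lra|]. rewrite <- Rinv_1. apply Rinv_le_contravar; lra. }
  generalize (Rabs_pos a). nra. }
assert (Hsign : exists eps, (eps = 1 \/ eps = -1) /\ 0 <= eps * Im (z ^ m)%C).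
{ destruct (Rle_lt_dec 0 (Im (z ^ m)%C)); [exists 1|exists (-1)]; split; auto; lra. }
destruct Hsign as [eps [He Hi]].
assert (Hcmp : forall t, 0 < t < 1 ->
  0 <= eps * Im (q s ((t * z) ^ m)%C) <= eps * Im (q 1 ((t * z) ^ m)%C)).
{ intros t Ht. apply Im_q_comparison; auto.
  - apply pow_disk; [exact Hm|]. apply scale_disk; [lra|exact Hz].
  - rewrite Cpow_mult_l, <- RtoC_pow.
    replace (Im (RtoC (t ^ m) * z ^ m)%C) with (t ^ m * Im (z ^ m)%C) by (unfold Im; simpl; ring).
    replace (eps * (t ^ m * Im (z ^ m)%C)) with (t ^ m * (eps * Im (z ^ m)%C)) by ring.
    apply Rmult_le_pos; [apply pow_le; lra|exact Hi]. }
assert (Im1 : forall x : C, Im (x - 1)%C = Im x) by (intros; unfold Im; simpl; ring).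
assert (B1 : 0 <= eps * Im (L z - L 0)%C).
{ apply ray_Im_nonneg with L'; [apply disk_deriv_log_series|exact Hz|]. intros t Ht.
  rewrite mult_id_log_series_deriv, Im1 by (apply scale_disk; [lra|exact Hz]). now apply Hcmp. }
assert (B2 : 0 <= eps * Im ((V z - L z) - (V 0 - L 0))%C).
{ apply (ray_Im_nonneg (fun z => V z - L z)%C (fun z => V' z - L' z)%C).
  - intros x Hx. apply Cder_minus; [now apply DV|now apply disk_deriv_log_series].
  - exact Hz.
  - intros t Ht. assert (Hd : in_disk (t * z)) by (apply scale_disk; [lra|exact Hz]).
    replace (t * z * (V' (t * z) - L' (t * z)))%C with (t * z * V' (t * z) - t * z * L' (t * z))%C by ring.
    rewrite IV, mult_id_log_series_deriv by exact Hd.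
    replace (Im (q 1 ((t * z) ^ m) - 1 - (q s ((t * z) ^ m) - 1))%C)
      with (Im (q 1 ((t * z) ^ m)%C) - Im (q s ((t * z) ^ m)%C)) by (unfold Im; simpl; ring).
    specialize (Hcmp t Ht). lra. }
rewrite log_series_0 in B1, B2. rewrite V0 in B2.
replace (Im (L z - 0)%C) with (Im (L z)) in B1 by (unfold Im; simpl; ring).
replace (Im (V z - L z - (0 - 0))%C) with (Im (V z) - Im (L z)) in B2 by (unfold Im; simpl; ring).
apply Rabs_def2 in VB. apply Rabs_def1; destruct He as [-> | ->]; lra.
Qed.

(** [h' = Cexp L] has positive real part because [|Im L| < PI / 2], so [h] is
    univalent; the subordination holds with [omega z = z^m]. *)
Lemma extremal_function :
  exists (h : C -> C) (d : nat -> C),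
    class_CV_hpl s h /\ normalized_expansion h d /\
    d 2%nat = RtoC (b 1%nat / 2) /\ d 3%nat = RtoC ((b 1%nat ^ 2 + b 2%nat) / 6).
Proof.
set (e := exp_coeff b). set (a := prim e).
assert (Be : forall n, 0 <= e n <= 1) by (apply exp_coeff_bounds, q_coeff_unit_interval).
set (y := PS (fun n => RtoC (e n))). set (h := PS (fun n => RtoC (a n))).
assert (Ce : disk_coeffs (fun n => RtoC (e n))) by (apply disk_coeffs_bounded, Be).
assert (Ca : disk_coeffs (fun n => RtoC (a n))) by (apply disk_coeffs_bounded, prim_bounds, Be).
assert (Dh : disk_deriv h y) by (apply disk_deriv_prim, Be).
assert (Ey : forall z, in_disk z -> y z = Cexp (L z)) by (apply exp_series_sum, q_coeff_unit_interval).
assert (Dy : disk_deriv y (fun z => Cexp (L z) * L' z)%C).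
{ intros z Hz. apply Cder_ext_disk with (fun z => Cexp (L z)); [intros; symmetry; now apply Ey|exact Hz|].
  apply (Cder_comp Cexp L); [apply Cder_Cexp|now apply disk_deriv_log_series]. }
assert (Nh : normalized_expansion h (fun n => RtoC (a n))).
{ split; [reflexivity|split].
  - unfold a, prim, e, exp_coeff. simpl. f_equal. field.
  - intros z Hz. now apply is_pseries_PS. }
exists h, (fun n => RtoC (a n)). split; [|split; [exact Nh|]].
- split; [split; [|split]|].
  + intros z Hz. exists (y z). now apply Cder_is_derive, Dh.
  + apply noshiro_warschawski with y; [exact Dh|]. intros z Hz. rewrite Ey by exact Hz.
    change (0 < exp (Re (L z)) * cos (Im (L z))). apply Rmult_lt_0_compat; [apply exp_pos|].
    assert (B := Im_log_series_bound z Hz). apply Rabs_def2 in B as [B1 B2]. apply cos_gt_0; lra.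
  + now exists (fun n => RtoC (a n)).
  + exists (fun z => z ^ m)%C. split; [|split; [|split]].
    * intros z Hz. exists (dpow m z). now apply Cder_is_derive, disk_deriv_pow.
    * intros z Hz. now apply pow_disk.
    * now apply pow_0_pos.
    * intros z Hz. rewrite (disk_deriv_C_derive2 h y _ z Dh Dy Hz), (disk_deriv_C_derive h y z Dh Hz), Ey by exact Hz.
      replace (q s (z ^ m)%C) with (1 + (q s (z ^ m) - 1))%C by ring. rewrite <- mult_id_log_series_deriv by exact Hz.
      field. apply Cexp_nz.
- assert (E0 : e 0%nat = 1) by reflexivity.
  assert (E1 : e 1%nat = b 1%nat).
  { assert (R := exp_coeff_rec b 0). fold e in R. simpl in R. rewrite E0 in R. lra. }
  assert (E2 : 2 * e 2%nat = b 1%nat ^ 2 + b 2%nat).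
  { assert (R := exp_coeff_rec b 1). fold e in R. simpl in R. rewrite E0, E1 in R. lra. }
  unfold a, prim. rewrite E1. split.
  + simpl. reflexivity.
  + f_equal. rewrite <- E2. simpl. field.
Qed.
End Extremal.

Theorem theorem3p7 (s lambda : R) (hs0 : 0 < s) (hs1 : s <= 1) :
  (forall (h : C -> C) (d : nat -> C),
     class_CV_hpl s h -> normalized_expansion h d ->
     (lambda <= (3 * s - 1) / (3 * s) ->
        Cmod (d 3%nat - RtoC lambda * d 2%nat ^ 2)%C
          <= - (s ^ 2 / 4) * (lambda - (3 * s + 1) / (3 * s))) /\
     ((3 * s - 1) / (3 * s) <= lambda <= (s + 1) / s ->
        Cmod (d 3%nat - RtoC lambda * d 2%nat ^ 2)%C <= s / 6) /\
     ((s + 1) / s <= lambda ->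
        Cmod (d 3%nat - RtoC lambda * d 2%nat ^ 2)%C
          <= s ^ 2 / 4 * (lambda - (3 * s + 1) / (3 * s))))
  /\
  (exists (h : C -> C) (d : nat -> C),
     class_CV_hpl s h /\ normalized_expansion h d /\
     (lambda <= (3 * s - 1) / (3 * s) ->
        Cmod (d 3%nat - RtoC lambda * d 2%nat ^ 2)%C
          = - (s ^ 2 / 4) * (lambda - (3 * s + 1) / (3 * s))) /\
     ((3 * s - 1) / (3 * s) <= lambda <= (s + 1) / s ->
        Cmod (d 3%nat - RtoC lambda * d 2%nat ^ 2)%C = s / 6) /\
     ((s + 1) / s <= lambda ->
        Cmod (d 3%nat - RtoC lambda * d 2%nat ^ 2)%C
          = s ^ 2 / 4 * (lambda - (3 * s + 1) / (3 * s)))).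
Proof.
set (mu := (3 * s + 1 - 3 * lambda * s) / 2).
set (M := s / 6 * Rmax 1 (Rabs mu)).
assert (Vlow : lambda <= (3 * s - 1) / (3 * s) ->
  M = - (s ^ 2 / 4) * (lambda - (3 * s + 1) / (3 * s))).
{ intros H. apply Rmult_le_compat_l with (r := 3 * s) in H; [|lra].
  replace (3 * s * ((3 * s - 1) / (3 * s))) with (3 * s - 1) in H by (field; lra).
  assert (1 <= mu) by (unfold mu; lra).
  unfold M. rewrite Rabs_pos_eq, Rmax_right by lra. unfold mu. field; lra. }
assert (Vmid : (3 * s - 1) / (3 * s) <= lambda <= (s + 1) / s -> M = s / 6).
{ intros [H H']. apply Rmult_le_compat_l with (r := 3 * s) in H, H'; [|lra..].
  replace (3 * s * ((3 * s - 1) / (3 * s))) with (3 * s - 1) in H by (field; lra).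
  replace (3 * s * ((s + 1) / s)) with (3 * s + 3) in H' by (field; lra).
  assert (-1 <= mu <= 1) by (unfold mu; lra).
  unfold M. rewrite Rmax_left; [lra|]. apply Rabs_le; lra. }
assert (Vhigh : (s + 1) / s <= lambda -> M = s ^ 2 / 4 * (lambda - (3 * s + 1) / (3 * s))).
{ intros H. apply Rmult_le_compat_l with (r := 3 * s) in H; [|lra].
  replace (3 * s * ((s + 1) / s)) with (3 * s + 3) in H by (field; lra).
  assert (mu <= -1) by (unfold mu; lra).
  unfold M. rewrite Rabs_left1, Rmax_right by lra. unfold mu. field; lra. }
split.
- intros h d Hh Hd. assert (B := fekete_szego_bound s lambda h d hs0 Hh Hd). fold mu M in B.
  split; [|split]; intros H; [rewrite <- Vlow|rewrite <- Vmid|rewrite <- Vhigh]; assumption.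
- assert (Att : exists (h : C -> C) (d : nat -> C), class_CV_hpl s h /\ normalized_expansion h d /\
     Cmod (d 3%nat - RtoC lambda * d 2%nat ^ 2)%C = M).
  { destruct (Rle_lt_dec 1 (Rabs mu)) as [Hmu|Hmu].
    - destruct (extremal_function s 1 (conj hs0 hs1) (le_n 1)) as [h [d [Hh [Hd [E2 E3]]]]].
      exists h, d. split; [exact Hh|split; [exact Hd|]]. rewrite E2, E3.
      unfold M. rewrite Rmax_right by exact Hmu.
      rewrite <- RtoC_pow, <- RtoC_mult, <- RtoC_minus, Cmod_R.
      rewrite <- (Rabs_pos_eq (s / 6)) by lra. rewrite <- Rabs_mult. f_equal.
      unfold q_coeff, mu. simpl. field.
    - destruct (extremal_function s 2 (conj hs0 hs1) (le_S _ _ (le_n 1))) as [h [d [Hh [Hd [E2 E3]]]]].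
      exists h, d. split; [exact Hh|split; [exact Hd|]]. rewrite E2, E3.
      unfold M. rewrite Rmax_left by lra.
      rewrite <- RtoC_pow, <- RtoC_mult, <- RtoC_minus, Cmod_R.
      rewrite Rmult_1_r. rewrite Rabs_pos_eq; unfold q_coeff; simpl; lra. }
  destruct Att as [h [d [Hh [Hd E]]]]. exists h, d.
  split; [exact Hh|split; [exact Hd|]]. rewrite E. auto.
Qed.
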